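(* Let $G$ be an infinite $R$-analytic profinite group and let $H$ be an $R$-analytic subgroup of $G$. Then \[ \operatorname{hDim}_{\mathrm{Std}}(H)=\frac{\dim(H)}{\dim(G)}, \] where $\operatorname{hDim}_{\mathrm{Std}}(H)$ is the standard Hausdorff dimension of $H$ in $G$, i.e. the Hausdorff dimension of $H$ with respect to the natural filtration of $G$ induced by any given open $R$-standard subgroup of $G$.
   Context: Throughout, $R$ is a pro-$p$ ring, i.e. a commutative Noetherian complete local ring with maximal ideal $\mathfrak m$ and finite residue field $R/\mathfrak m$ of characteristic $p$, and its associated graded ring $\bigoplus_{n\ge 0}\mathfrak m^n/\mathfrak m^{n+1}$ is assumed to be an integral domain. Hence $R$ is an integral domain; $K$ denotes its field of fractions. $X^{(d)}$ denotes the cartesian product of $d$ copies of a set $X$. $R$-analytic manifolds and groups (in the sense of Dixon, du Sautoy, Mann, Segal, ''Analytic pro-$p$ groups'', Chapter 13). Put $|0|=0$ and $|x|=c^{-n}$ for $x\in\mathfrak m^n\smallsetminus\mathfrak m^{n+1}$ ($c>1$ fixed); this extends to an absolute value on $K$. A function from an open subset $V$ of $R^{(r)}$ to $R^{(s)}$ is analytic if near each point $y\in V$, i.e. on $y+(\mathfrak m^{\ell})^{(r)}$ for some $\ell$, its components are given by formal power series over $K$ in the coordinates of $x-y$ that converge there. An $R$-analytic manifold of dimension $d$ is a topological space with a full (maximal) atlas of charts $(U,\phi)$, $\phi$ a homeomorphism of the open set $U$ onto an open subset of $R^{(d)}$, with analytic transition functions. An $R$-analytic group is a topological group that is an $R$-analytic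 manifold with analytic multiplication and inversion; $\dim$ denotes dimension as an analytic manifold. An $R$-analytic profinite group is an $R$-analytic group that is profinite as a topological group. An $R$-analytic subgroup $H$ of $G$ ($\dim G=d$) is a subgroup that is also an analytic submanifold in Serre's sense: for every $x\in H$ there are a chart $(V,\phi)$ of $G$ at $x$ with $\phi(x)=0$ and a vector subspace $E$ of $K^{(d)}$ with $\phi(H\cap V)=E\cap\phi(V)$; then $\dim(H)=\dim_K E$. Such an $H$ is closed in $G$. Standard groups. An $R$-standard group $(S,\phi)$ of level $N\ge 1$ is an $R$-analytic group $S$ with a global chart given by a homeomorphism $\phi:S\to(\mathfrak m^N)^{(d)}$ such that $\phi(1)=0$ and there are power series $F_1,\dots,F_d\in R[[X,Y]]$ ($X,Y$ being $d$-tuples of indeterminates) without constant term such that $\phi(xy)=F(\phi(x),\phi(y))$ for all $x,y\in S$, where $F=(F_1,\dots,F_d)$. An open standard subgroup of $G$ is an open subgroup $S$ with a chart $(S,\phi)$ of $G$ making it an $R$-standard group; every $R$-analytic group contains one. Put $\mathfrak m^n_\phi S=\phi^{-1}((\mathfrak m^{N+n})^{(d)})$ for $n\ge 0$. These are open subgroups of $G$, and $\{\mathfrak m^n_\phi S\}_{n}$ is a filtration of $G$, the natural filtration of $G$ induced by $S$. Hausdorff dimension. A filtration of a countably based infinite profinite group $G$ is a descending series $\{G_n\}$ of open subgroups of $G$ forming a base of neighbourhoods of $1$. It defines the metric $d(x,y)=\inf\{|G:G_n|^{-1}\mid xy^{-1}\in G_n\}$ (with $d(x,y)=1$ if $xy^{-1}$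 lies in no $G_n$), and $\operatorname{hDim}_{\{G_n\}}(X)$ is the Hausdorff dimension of $X\subseteq G$ with respect to this metric. $R$-analytic profinite groups are countably based. The standard Hausdorff dimension $\operatorname{hDim}_{\mathrm{Std}}(H)$ of a closed subgroup $H$ is $\operatorname{hDim}_{\{\mathfrak m^n_\phi S\}}(H)$ for any open standard subgroup $(S,\phi)$ of $G$; this does not depend on the choice of $(S,\phi)$. *)

(* Defs.v *)
From HB Require Import structures.
From mathcomp Require Import all_boot all_order all_algebra finmap.
From mathcomp Require Import all_classical all_reals all_analysis.
Set Implicit Arguments.
Unset Strict Implicit.
Unset Printing Implicit Defensive.
Import Order.TTheory GRing.Theory Num.Theory.
Local Open Scope classical_set_scope.
Local Open Scope ring_scope.

Section Ideals.
Variable R : idomainType.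

Definition is_ideal (I : set R) : Prop :=
  [/\ I 0, (forall x y, I x -> I y -> I (x + y))
    & (forall a x, I x -> I (a * x))].

Definition maximal_ideal (I : set R) : Prop :=
  [/\ is_ideal I, I <> [set: R]
    & forall J, is_ideal J -> I `<=` J -> J = I \/ J = [set: R]].

Definition ideal_mul (I J : set R) : set R :=
  smallest is_ideal [set x * y | x in I & y in J].

Fixpoint ideal_pow (I : set R) (n : nat) : set R :=
  if n is n'.+1 then ideal_mul I (ideal_pow I n') else [set: R].

Definition noetherian : Prop :=
  forall I, is_ideal I -> exists s : seq R, I = smallest is_ideal [set` s].

(* An element of the associated graded ring is represented by a polynomial
   whose n-th coefficient lies in m^n and represents the component in
   m^n / m^n.+1; the product of polynomials represents the product. *)
Definition gr_repr (m : set R) (a : {poly R}) : Prop :=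
  forall n, ideal_pow m n a`_n.

Definition gr_zero (m : set R) (a : {poly R}) : Prop :=
  forall n, ideal_pow m n.+1 a`_n.

Definition gr_domain (m : set R) : Prop :=
  ~ gr_zero m 1 /\
  (forall a b, gr_repr m a -> gr_repr m b ->
     gr_zero m (a * b) -> gr_zero m a \/ gr_zero m b).

(* The two clauses are the injectivity and the surjectivity of
   R -> lim_n R / m^n. *)
Definition adic_complete (m : set R) : Prop :=
  (forall x, (forall n, ideal_pow m n x) -> x = 0) /\
  (forall u : nat -> R, (forall n, ideal_pow m n (u n.+1 - u n)) ->
     exists l, forall n, ideal_pow m n (u n - l)).

(* Being an integral domain follows from gr_domain and completeness, so taking
   R to be an idomainType loses no generality. *)
Record pro_p_ring (p : nat) (m : set R) : Prop := ProPRing {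
  pro_p_maximal : maximal_ideal m;
  pro_p_local : forall m', maximal_ideal m' -> m' = m;
  pro_p_noetherian : noetherian;
  pro_p_complete : adic_complete m;
  pro_p_residue_finite :
    finite_set (range (fun x => [set y | m (y - x)]));
  pro_p_prime : prime p;
  pro_p_residue_char : m p%:R;
  pro_p_graded : gr_domain m
}.

(* (m^n)^(r) *)
Definition ideal_powV (m : set R) (r n : nat) : set 'rV[R]_r :=
  [set x | forall i, ideal_pow m n (x ord0 i)].

Lemma is_ideal_pow m n : is_ideal (ideal_pow m n).
Proof.
case: n => [|n] /=; first by split.
split=> [I [[I0 _ _] _]|x y Hx Hy I II|a x Hx I II] //.
- by case: (II) => -[_ ID _] _; apply: ID; [exact: Hx|exact: Hy].
- by case: (II) => -[_ _ IM] _; apply: IM; exact: Hx.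
Qed.

Lemma ideal_powS m n : ideal_pow m n.+1 `<=` ideal_pow m n.
Proof.
move=> x; apply; split; first exact: is_ideal_pow.
by move=> _ [a _ [b Hb <-]]; case: (is_ideal_pow m n) => _ _; apply.
Qed.

Lemma ideal_pow_le m k n : (k <= n)%N -> ideal_pow m n `<=` ideal_pow m k.
Proof.
elim: n => [|n IH]; first by rewrite leqn0 => /eqP->.
rewrite leq_eqVlt => /predU1P[->//|kn].
by apply: subset_trans (@ideal_powS m n) (IH _).
Qed.

Lemma ideal_powV_le m r k n :
  (k <= n)%N -> @ideal_powV m r n `<=` ideal_powV m k.
Proof. by move=> kn x Hx i; exact: (ideal_pow_le kn (Hx i)). Qed.

End Ideals.

(* R^(r) with the m-adic topology. *)
Definition adic (R : idomainType) (m : set R) (r : nat) := 'rV[R]_r.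

Section AdicTopology.
Variables (R : idomainType) (m : set R) (r : nat).

HB.instance Definition _ := GRing.Zmodule.on (adic m r).

Definition adic_open (V : set (adic m r)) : Prop :=
  forall y, V y -> exists l, [set x | ideal_powV m l (x - y)] `<=` V.

Lemma adic_openT : adic_open setT.
Proof. by move=> y _; exists 0%N. Qed.

Lemma adic_openI : setI_closed adic_open.
Proof.
move=> A B oA oB y [/oA[k Ak] /oB[l Bl]]; exists (maxn k l) => x /= Hx.
split; [apply: Ak|apply: Bl]; apply: ideal_powV_le Hx.
- exact: leq_maxl.
- exact: leq_maxr.
Qed.

Lemma adic_open_bigU (I : Type) (f : I -> set (adic m r)) :
  (forall i, adic_open (f i)) -> adic_open (\bigcup_i f i).
Proof.
move=> of_ y [i _ /of_[l Hl]]; exists l => x /Hl fx.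
by exists i.
Qed.

HB.instance Definition _ :=
  isOpenTopological.Build (adic m r) adic_openT adic_openI adic_open_bigU.

End AdicTopology.

Section Analytic.
Variables (RR : realType) (c : RR) (R : idomainType) (m : set R).

Definition adic_ord (x : R) : nat :=
  xget 0%N [set n | ideal_pow m n x /\ ~ ideal_pow m n.+1 x].

Definition adic_abs (x : R) : RR := if x == 0 then 0 else c ^- adic_ord x.

Definition fraction_abs (z : {fraction R}) : RR :=
  adic_abs (frac (repr z)).1 / adic_abs (frac (repr z)).2.

Definition exponent (r : nat) := {ffun 'I_r -> nat}.

(* Unconditional convergence in K, which need not be complete. *)
Definition sums_to (I : choiceType) (a : I -> {fraction R})
    (s : {fraction R}) : Prop :=
  forall eps : RR, 0 < eps -> exists A : {fset I}, forall B : {fset I},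
    (A `<=` B)%fset -> fraction_abs (s - \sum_(i <- B) a i) < eps.

(* The power series with coefficients F converges at v, with sum s. *)
Definition series_value (r : nat) (F : exponent r -> {fraction R})
    (v : 'rV[R]_r) (s : R) : Prop :=
  sums_to (fun alpha : exponent r =>
    F alpha * \prod_(i < r) (tofrac (v ord0 i)) ^+ alpha i) (tofrac s).

Definition analytic_on (r s : nat) (V : set (adic m r))
    (f : adic m r -> adic m s) : Prop :=
  forall y, V y -> exists (l : nat) (F : 'I_s -> exponent r -> {fraction R}),
    forall x, ideal_powV m l (x - y) ->
      V x /\ forall i, series_value (F i) (x - y) (f x ord0 i).

(* A chart is a pair (U, phi); the values of phi outside U are irrelevant. *)
Definition chart (M : Type) (d : nat) : Type := (set M * (M -> adic m d))%type.

Definition is_chart (M : topologicalType) (d : nat) (C : chart M d) : Prop :=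
  [/\ open C.1, open (C.2 @` C.1), set_inj C.1 C.2,
      {within C.1, continuous C.2}
    & forall W, open W -> W `<=` C.1 -> open (C.2 @` W)].

(* The map psi o f o phi^-1 is analytic on phi (U `&` f @^-1` V). *)
Definition analytic_in_charts (M N : Type) (d e : nat)
    (C : chart M d) (D : chart N e) (f : M -> N) : Prop :=
  let W := C.1 `&` f @^-1` D.1 in
  exists2 g : adic m d -> adic m e, analytic_on (C.2 @` W) g
    & forall x, W x -> g (C.2 x) = D.2 (f x).

Definition compatible (M : Type) (d : nat) (C D : chart M d) : Prop :=
  analytic_in_charts C D id /\ analytic_in_charts D C id.

Record full_atlas (M : topologicalType) (d : nat) (A : set (chart M d)) :
    Prop := FullAtlas {
  atlas_chart : forall C, A C -> is_chart C;
  atlas_cover : forall x, exists2 C, A C & C.1 x;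
  atlas_compatible : forall C D, A C -> A D -> compatible C D;
  atlas_maximal : forall C, is_chart C ->
    (forall D, A D -> compatible C D) -> A C
}.

Definition analytic_map (M N : topologicalType) (d e : nat)
    (A : set (chart M d)) (B : set (chart N e)) (f : M -> N) : Prop :=
  continuous f /\ forall C D, A C -> B D -> analytic_in_charts C D f.

Definition prod_chart (M N : Type) (d e : nat) (C : chart M d)
    (D : chart N e) : chart (M * N) (d + e) :=
  (C.1 `*` D.1, fun z => row_mx (C.2 z.1) (D.2 z.2)).

Definition prod_atlas (M N : Type) (d e : nat) (A : set (chart M d))
    (B : set (chart N e)) : set (chart (M * N) (d + e)) :=
  [set prod_chart C D | C in A & D in B].

End Analytic.

HB.mixin Record isTopologicalGroup G & Group G & Topological G := {
  mulg_continuous : continuous (fun z : G * G => (z.1 * z.2)%g);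
  invg_continuous : continuous (fun x : G => (x^-1)%g)
}.

#[short(type="topologicalGroupType")]
HB.structure Definition TopologicalGroup :=
  {G of Group G & Topological G & isTopologicalGroup G}.

Definition profinite (G : topologicalGroupType) : Prop :=
  [/\ compact [set: G], hausdorff_space G & totally_disconnected [set: G]].

Definition is_subgroup (G : groupType) (H : set G) : Prop :=
  [/\ H 1%g, (forall x y, H x -> H y -> H (x * y)%g)
    & forall x, H x -> H (x^-1)%g].

(* The index |G : K|, with the junk value 0 when it is infinite. *)
Definition subgroup_index (G : groupType) (K : set G) : nat :=
  #|` fset_set (range (fun x : G => [set (k * x)%g | k in K]))|.

Section AnalyticGroups.
Variables (RR : realType) (c : RR) (R : idomainType) (m : set R).
Variables (d : nat) (G : topologicalGroupType).
Implicit Type A : set (chart m G d).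

Record analytic_group A : Prop := AnalyticGroup {
  analytic_group_atlas : full_atlas c A;
  analytic_group_mul :
    analytic_map c (prod_atlas A A) A (fun z : G * G => (z.1 * z.2)%g);
  analytic_group_inv : analytic_map c A A (fun x : G => (x^-1)%g)
}.

(* The chart C at x linearizes H, with E as the corresponding subspace. *)
Definition adapted_chart A (H : set G) (x : G) (C : chart m G d)
    (E : {vspace 'rV[{fraction R}]_d}) : Prop :=
  [/\ A C, C.1 x, C.2 x = 0
    & C.2 @` (H `&` C.1) =
      [set v : adic m d | map_mx (@tofrac R) v \in E] `&` C.2 @` C.1].

Definition analytic_subgroup A (H : set G) : Prop :=
  is_subgroup H /\ forall x, H x -> exists C E, adapted_chart A H x C E.

(* dim H = e: the dimension of E does not depend on the choice of the point
   and of the adapted chart. *)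
Definition analytic_subgroup_dim A (H : set G) (e : nat) : Prop :=
  exists x C E, [/\ H x, adapted_chart A H x C E & \dim E = e].

Definition open_standard_subgroup A (N : nat) (S : set G)
    (phi : G -> adic m d) : Prop :=
  [/\ (0 < N)%N, is_subgroup S /\ open S, A (S, phi),
      phi @` S = @ideal_powV R m d N /\ phi 1%g = 0
    & exists F : 'I_d -> exponent (d + d) -> R,
        (forall i, F i [ffun=> 0%N] = 0) /\
        (forall x y, S x -> S y -> forall i,
          series_value c m (fun alpha => tofrac (F i alpha))
            (row_mx (phi x) (phi y)) (phi (x * y)%g ord0 i))].

Definition natural_filtration (N : nat) (S : set G) (phi : G -> adic m d)
    (n : nat) : set G :=
  S `&` phi @^-1` (@ideal_powV R m d (N + n)).

End AnalyticGroups.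

Section HausdorffDimension.
Variable RR : realType.

Section Metric.
Variables (T : Type) (dist : T -> T -> RR).
Local Open Scope ereal_scope.

Definition diameter (U : set T) : \bar RR :=
  ereal_sup [set (dist x y)%:E | x in U & y in U].

(* The test makes the empty set contribute 0, also for s = 0. *)
Definition diameter_pow (s : RR) (U : set T) : \bar RR :=
  if `[< U = set0 >] then 0 else diameter U `^ s.

Definition hausdorff_premeasure (s delta : RR) (X : set T) : \bar RR :=
  ereal_inf [set \sum_(0 <= i <oo) diameter_pow s (U i) | U in
    [set U : nat -> set T | X `<=` \bigcup_i U i /\
                            forall i, diameter (U i) <= delta%:E]].

Definition hausdorff_measure (s : RR) (X : set T) : \bar RR :=
  ereal_sup [set hausdorff_premeasure s delta X | delta in
    [set delta : RR | (0 < delta)%R]].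

Definition hausdorff_dim (X : set T) : \bar RR :=
  ereal_inf [set s%:E | s in
    [set s : RR | (0 <= s)%R /\ hausdorff_measure s X = 0]].

End Metric.

Definition filtration_dist (G : groupType) (Gn : nat -> set G) (x y : G) : RR :=
  if `[< exists n, Gn n (x * y^-1)%g >]
  then inf [set ((subgroup_index (Gn n))%:R : RR)^-1 |
             n in [set n | Gn n (x * y^-1)%g]]
  else 1.

Definition hDim (G : groupType) (Gn : nat -> set G) (X : set G) : \bar RR :=
  hausdorff_dim (filtration_dist Gn) X.

End HausdorffDimension.

(* Main.v *)
From HB Require Import structures.
Require Import Defs.
From mathcomp Require Import all_boot all_order all_algebra finmap.
From mathcomp Require Import all_classical all_reals all_analysis.
From mathcomp Require Import zify ring lra.
Set Implicit Arguments.
Unset Strict Implicit.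
Unset Printing Implicit Defensive.
Import Order.TTheory GRing.Theory Num.Theory.
Local Open Scope classical_set_scope.
Local Open Scope ring_scope.

(** Analytic maps are locally Lipschitz for the m-adic distances. Combined with
    a basis with coefficients in [R] of the subspace [E] linearizing [H], this
    bounds the number of cosets of the [n]-th filtration subgroup that meet [H]
    between |R/m^(n-k)|^e and C |R/m^(n+k)|^e. Taking [H = G] gives the same
    bounds for the index of the filtration subgroups, with [d] instead of [e].
    Counting standard monomials in generators of [m] shows
    |R/m^(n+k)| <= |R/m^n|^(1+o(1)), so the ratio of the logarithms of the two
    counts tends to [e / d]. The upper bound on the dimension then follows by
    covering [H] with cosets, and the lower bound by distributing mass
    uniformly over the cosets meeting [H], which is compact. *)

(** Once [R] has Krull dimension above 1, [|R/m^n|] is not geometric in [n]: a bounded shift of [n]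
    changes it by an unbounded factor. The counts are thus not known up to constants, and nothing is
    claimed about the measure at the critical exponent. Only logarithms are compared, with [s]
    strictly below or above [e/d]. No Hilbert polynomial is required for this. If [h] is the Hilbert
    function of the graded ring for [r] generators, then [(n+1) h(n+1) <= (n+r) h(n)], and this
    inequality alone makes the partial sums [a] of [h] satisfy [a(n+k)/a(n) -> 1]. Nor is [R] a
    discrete valuation ring in general: there is no uniformizer, and the vectors of [E] with entries
    in [R] need not form a free module. A nonzero element [pi] of [m] and a denominator [b] stand
    in. Dividing by them shifts exponents by a constant because the adic order is additive, which is
    the form in which the assumption on the graded ring enters. *)

Section Counting.
Variables (T : Type) (U : choiceType) (f : T -> U).

(** Of the same form as [subgroup_index], which is by conversion the case of the right cosets in the
    whole group. An infinite image would count 0, hence the finiteness hypotheses below. *)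
Definition nclasses (X : set T) : nat := #|` fset_set (f @` X)|.

Lemma nclasses_enum (X : set T) : finite_set (f @` X) ->
  exists g : 'I_(nclasses X) -> T, [/\ forall i, X (g i),
    forall i j, f (g i) = f (g j) -> i = j
    & forall x, X x -> exists i, f x = f (g i)].
Proof.
move=> fin; rewrite /nclasses; set A := fset_set _.
have memA y : (y \in A) -> exists2 x, X x & f x = y.
  by rewrite in_fset_set // inE.
have /choice[g0 g0P] (y : A) : exists x, X x /\ f x = fsval y.
  by have [x Xx xy] := memA _ (fsvalP y); exists x.
rewrite cardfE; exists (fun i => g0 (enum_val i)); split.
- by move=> i; have [] := g0P (enum_val i).
- move=> i j; have [_ ->] := g0P (enum_val i); have [_ ->] := g0P (enum_val j).
  by move=> /val_inj /enum_val_inj.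
- move=> x Xx; have xA : f x \in A by rewrite in_fset_set // inE; exists x.
  exists (enum_rank [` xA]%fset); rewrite enum_rankK.
  by have [_ ->] := g0P [` xA]%fset.
Qed.

Lemma leq_nclasses (I : finType) (X : set T) (h : I -> T) :
  finite_set (f @` X) -> (forall i, X (h i)) ->
  (forall i j, f (h i) = f (h j) -> i = j) -> (#|I| <= nclasses X)%N.
Proof.
move=> fin Xh hI; rewrite /nclasses cardfE.
have hA i : f (h i) \in fset_set (f @` X).
  by rewrite in_fset_set // inE; exists (h i).
apply: (@leq_card _ _ (fun i => [` hA i]%fset)) => i j /(congr1 val) /=.
exact: hI.
Qed.

Lemma nclasses_leq (I : finType) (X : set T) (h : T -> I) :
  finite_set (f @` X) ->
  (forall x y, X x -> X y -> h x = h y -> f x = f y) -> (nclasses X <= #|I|)%N.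
Proof.
move=> fin hf; have [g [Xg gI _]] := nclasses_enum fin.
rewrite -[leqLHS]card_ord; apply: (@leq_card _ _ (h \o g)) => i j /= hij.
by apply: gI; apply: hf.
Qed.

Lemma finite_nclasses (I : finType) (X : set T) (h : T -> I) :
  (forall x y, X x -> X y -> h x = h y -> f x = f y) -> finite_set (f @` X).
Proof.
move=> hf; have [->|/set0P[x0 Xx0]] := eqVneq X set0.
  by rewrite image_set0.
have /choice[g gP] (i : I) :
    exists x, X x /\ forall y, X y -> h y = i -> f y = f x.
  have [[y [Xy yi]]|no] := pselect (exists y, X y /\ h y = i).
    by exists y; split=> // z Xz zi; apply: hf; rewrite ?yi.
  by exists x0; split=> // y Xy yi; case: no; exists y.
apply: (@sub_finite_set _ _ ((f \o g) @` [set: I])); last first.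
  by apply: finite_image; exact: finite_finset.
move=> _ [x Xx <-]; exists (h x) => //=.
by have [_ /(_ x Xx erefl)] := gP (h x).
Qed.

Lemma nclasses_gt0 (X : set T) : finite_set (f @` X) -> X !=set0 ->
  (0 < nclasses X)%N.
Proof.
move=> fin [x Xx]; rewrite -card_unit.
by apply: (@leq_nclasses unit _ (fun=> x)) => // -[] [].
Qed.

End Counting.

(** * Powers of the maximal ideal and standard monomials *)

Section IdealPowers.
Variables (R : idomainType) (m : set R).
Local Notation "m^ n" := (ideal_pow m n) (at level 2, n at level 1, format "m^ n").

Section Ideal.
Variables (I : set R) (idI : is_ideal I).

Lemma ideal0 : I 0. Proof. by case: idI. Qed.

Lemma idealD x y : I x -> I y -> I (x + y).
Proof. by case: idI => _ + _; apply. Qed.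

Lemma idealMl a x : I x -> I (a * x).
Proof. by case: idI => _ _; apply. Qed.

Lemma idealMr a x : I x -> I (x * a).
Proof. by rewrite mulrC; exact: idealMl. Qed.

Lemma idealN x : I x -> I (- x).
Proof. by rewrite -mulN1r; exact: idealMl. Qed.

Lemma idealB x y : I x -> I y -> I (x - y).
Proof. by move=> Ix /idealN; exact: idealD. Qed.

Lemma idealBC x y : I (x - y) -> I (y - x).
Proof. by move=> /idealN; rewrite opprB. Qed.

Lemma idealB_trans y x z : I (x - y) -> I (y - z) -> I (x - z).
Proof. by move=> xy yz; have := idealD xy yz; rewrite subrKA. Qed.

Lemma ideal_sum (J : Type) (r : seq J) (P : pred J) (F : J -> R) :
  (forall j, P j -> I (F j)) -> I (\sum_(j <- r | P j) F j).
Proof.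
by move=> IF; apply: big_ind => //; [exact: ideal0 | exact: idealD].
Qed.

End Ideal.

Lemma smallest_ideal (X : set R) : is_ideal (smallest (@is_ideal R) X).
Proof.
split=> [I [[]]//|x y Ix Iy I [iI XI]|a x Ix I [iI XI]].
- by apply: (idealD iI); [exact: Ix|exact: Iy].
- by apply: (idealMl iI); exact: Ix.
Qed.

Lemma smallest_ideal_ind (X G : set R) z : smallest (@is_ideal R) G z ->
  is_ideal X -> G `<=` X -> X z.
Proof. by move=> Gz iX GX; exact: (smallest_sub iX GX Gz). Qed.

(** This lets membership of a product be checked on generators of one factor. *)
Lemma ideal_colon (I : set R) a : is_ideal I -> is_ideal [set z | I (a * z)].
Proof.
move=> iI; split=> /=; first by rewrite mulr0; exact: ideal0.
- by move=> x y Ix Iy; rewrite mulrDr; exact: idealD.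
- by move=> b x Ix; rewrite mulrCA; exact: idealMl.
Qed.

Lemma ideal_powD a b x y : m^a x -> m^b y -> m^(a + b) (x * y).
Proof.
elim: a x => [|a IHa] x /=; first by move=> _; exact: (idealMl (is_ideal_pow m b)).
move=> mx my; rewrite mulrC.
apply: (smallest_ideal_ind (X := [set z | ideal_pow m (a + b).+1 (y * z)]) mx).
  by apply: ideal_colon; exact: (is_ideal_pow m (a + b).+1).
move=> _ [u mu [v mv <-]] /=; rewrite mulrCA [y * v]mulrC.
by apply: sub_gen_smallest; exists u => //; exists (v * y) => //; exact: IHa.
Qed.

Lemma ideal_powX a k x : m^a x -> m^(k * a) (x ^+ k).
Proof.
by move=> mx; elim: k => [//|k IHk]; rewrite exprS mulSn; exact: ideal_powD.
Qed.

Hypothesis id_m : is_ideal m.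

Lemma ideal_pow1 x : m^1 x <-> m x.
Proof.
split=> [x0|mx]; last first.
  by apply: sub_gen_smallest; exists x => //; exists 1; rewrite ?mulr1.
by apply: (smallest_ideal_ind x0) => // _ [u mu [v _ <-]]; exact: idealMr.
Qed.

Definition residue n (x : R) : set R := [set y | m^n (y - x)].

Lemma residueP n x y : residue n x = residue n y <-> m^n (x - y).
Proof.
have iM := is_ideal_pow m n.
split=> [xy|xy].
  have : residue n x x by rewrite /residue /= subrr; exact: ideal0.
  by rewrite xy.
rewrite eqEsubset; split=> z /= zx; first exact: (idealB_trans iM zx).
by apply: (idealB_trans iM zx); exact: idealBC.
Qed.

Definition quot_card n := nclasses (residue n) [set: R].

Section Monomials.
Variables (r : nat) (x : 'I_r -> R).
Hypothesis m_gen : m = smallest (@is_ideal R) (range x).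

Definition mon (f : 'I_r -> nat) : R := \prod_i x i ^+ f i.
Definition mdeg (f : 'I_r -> nat) : nat := (\sum_i f i)%N.
Definition minc (i : 'I_r) (f : 'I_r -> nat) (j : 'I_r) : nat :=
  ((i == j) + f j)%N.

Lemma mdeg_inc i f : mdeg (minc i f) = (mdeg f).+1.
Proof.
rewrite /mdeg /minc big_split /= (bigD1 i) //= eqxx big1 // => j.
by rewrite eq_sym => /negPf->.
Qed.

Lemma mon_inc i f : mon (minc i f) = x i * mon f.
Proof.
rewrite /mon [LHS](bigD1 i) //= [in RHS](bigD1 i) //= mulrA -exprS /minc eqxx.
by congr (_ * _); apply: eq_bigr => j ji; rewrite eq_sym (negPf ji).
Qed.

Lemma mgen_in i : m (x i).
Proof. by rewrite m_gen; apply: sub_gen_smallest; exists i. Qed.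

Lemma mon_in f : m^(mdeg f) (mon f).
Proof.
rewrite /mon /mdeg; apply: (big_rec2 (fun a b => m^a b)) => // i a b _ mb.
apply: ideal_powD => //.
have := @ideal_powX 1 (f i) (x i); rewrite muln1; apply.
by apply/ideal_pow1; exact: mgen_in.
Qed.

Lemma ideal_pow_mon n :
  m^n `<=` smallest (@is_ideal R) [set mon f | f in [set f | mdeg f = n]].
Proof.
elim: n => [z _|n IHn].
  rewrite -[z]mulr1; apply: (idealMl (smallest_ideal _)).
  apply: sub_gen_smallest; exists (fun=> 0%N) => /=.
    by rewrite /mdeg big1.
  by rewrite /mon big1.
move=> z mz.
apply: (smallest_ideal_ind mz); first exact: smallest_ideal.
set J := smallest _ _; have iJ : is_ideal J by exact: smallest_ideal.
move=> _ [u + [v mv <-]]; rewrite mulrC m_gen => mu.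
apply: (smallest_ideal_ind (X := [set z | J (v * z)]) mu).
  exact: ideal_colon.
move=> _ [i _ <-] /=; rewrite mulrC.
apply: (smallest_ideal_ind (X := [set z | J (x i * z)]) (IHn _ mv)).
  exact: ideal_colon.
move=> _ [f fn <-] /=; apply: sub_gen_smallest; exists (minc i f).
  by rewrite /= mdeg_inc fn.
exact: mon_inc.
Qed.

Variable B : nat.

(* Weighing exponent vectors in base [B] orders the monomials with exponents
   less than [B] totally and compatibly with multiplication. *)
Definition mweight (f : 'I_r -> nat) : nat := (\sum_i f i * B ^ i)%N.

Lemma mweight_inc i f : mweight (minc i f) = (B ^ i + mweight f)%N.
Proof.
rewrite /mweight /minc (eq_bigr (fun j => (i == j) * B ^ j + f j * B ^ j)%N).
  rewrite big_split /= (bigD1 i) //= eqxx mul1n big1 ?addn0 // => j.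
  by rewrite eq_sym => /negPf ->.
by move=> j _; rewrite mulnDl.
Qed.

(** A monomial of degree [n] and weight [k] lies here when, modulo [m^(n+1)], it is a combination of
    lighter monomials of its degree, that is, when it leads a relation of the graded ring. *)
Definition below n k : set R := smallest (@is_ideal R)
  ([set mon f | f in [set f | mdeg f = n /\ (mweight f < k)%N]] `|` m^n.+1).

(** A variable adds the same amount [B ^ i] to every weight, so multiplication preserves the order:
    multiples of monomials that are not standard are not standard. *)
Lemma below_mul n k (i : 'I_r) z : below n k z -> below n.+1 (B ^ i + k) (x i * z).
Proof.
move=> bz.
apply: (smallest_ideal_ind (X := [set z | below n.+1 (B ^ i + k) (x i * z)]) bz).
  by apply: ideal_colon; exact: smallest_ideal.
move=> y /= [[f [fn fk] <-]|my]; apply: sub_gen_smallest.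
  by left; exists (minc i f); rewrite ?mon_inc //= mdeg_inc fn mweight_inc ltn_add2l.
by right; apply: (@ideal_powD 1) => //; apply/ideal_pow1; exact: mgen_in.
Qed.

Local Notation expo := {ffun 'I_r -> 'I_B}.
Definition exp_nat (a : expo) (i : 'I_r) : nat := a i.

(* The standard monomials of degree [n], as for a Groebner basis of the ideal of
   relations of the associated graded ring: their classes form a basis of
   m^n / m^(n+1). *)
Definition std n : {set expo} := [set a : expo | (mdeg (exp_nat a) == n) &&
  `[< ~ below n (mweight (exp_nat a)) (mon (exp_nat a)) >]].

Lemma in_std n a : a \in std n <-> mdeg (exp_nat a) = n /\
  ~ below n (mweight (exp_nat a)) (mon (exp_nat a)).
Proof.
by rewrite inE; split=> [/andP[/eqP ? /asboolP]//|[/eqP-> ?]]; apply/asboolP.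
Qed.

Lemma digits_inj k (f g : nat -> nat) : (forall i, f i < B)%N ->
  (forall i, g i < B)%N ->
  (\sum_(i < k) f i * B ^ i = \sum_(i < k) g i * B ^ i)%N ->
  forall i, (i < k)%N -> f i = g i.
Proof.
elim: k f g => [//|k IHk] f g fB gB.
have shift (h : nat -> nat) : (\sum_(i < k.+1) h i * B ^ i =
    h 0 + (\sum_(i < k) h i.+1 * B ^ i) * B)%N.
  rewrite big_ord_recl expn0 muln1; congr addn; rewrite big_distrl /=.
  by apply: eq_bigr => i _; rewrite -mulnA -expnSr.
rewrite !shift => fg.
have B0 : (0 < B)%N by apply: leq_ltn_trans (fB 0%N).
have fg0 : f 0%N = g 0%N.
  move: fg; rewrite addnC [RHS]addnC => /(congr1 (modn^~ B)).
  by rewrite /= !modnMDl !modn_small.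
move: fg; rewrite fg0 => /addnI /eqP; rewrite eqn_pmul2r // => /eqP fg.
by case=> [//|i]; rewrite ltnS; apply: (IHk (f \o succn) (g \o succn)) => // j /=.
Qed.

Lemma mweight_inj (a b : expo) :
  mweight (exp_nat a) = mweight (exp_nat b) -> a = b.
Proof.
move=> ab; apply/ffunP => i; apply/val_inj => /=.
pose ext (c : expo) k : nat := if insub k is Some j then c j else 0%N.
have B0 : (0 < B)%N by apply: leq_ltn_trans (ltn_ord (a i)).
have ext_lt c k : (ext c k < B)%N by rewrite /ext; case: insub.
have extE (c : expo) (j : 'I_r) : ext c j = c j by rewrite /ext valK.
have wE c : mweight (exp_nat c) = (\sum_(j < r) ext c j * B ^ j)%N.
  by apply: eq_bigr => j _; rewrite extE.
rewrite !wE in ab.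
by have := digits_inj (ext_lt a) (ext_lt b) ab (ltn_ord i); rewrite !extE.
Qed.

Lemma below_std n k z : below n k z ->
  forall I : set R, is_ideal I -> m^n.+1 `<=` I ->
  (forall f, mdeg f = n -> (mweight f < k)%N -> I (mon f)) -> I z.
Proof.
move=> bz I iI mI monI; apply: (smallest_ideal_ind bz) => // y /=.
by case=> [[f [fn fk] <-]|]; [exact: monI|exact: mI].
Qed.

Lemma leq_mdeg f i : (f i <= mdeg f)%N.
Proof. by rewrite /mdeg (bigD1 i) //= leq_addr. Qed.

(** Induction on the weight: a monomial that is not standard is, modulo [m^(n+1)], a combination of
    lighter ones. The bound [n < B] makes the exponents of a monomial of degree [n] fit in
    ['I_B]. *)
Lemma std_span n z : (n < B)%N -> m^n z -> exists c : 'I_#|std n| -> R,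
  m^n.+1 (z - \sum_i c i * mon (exp_nat (enum_val i))).
Proof.
move=> nB; have iS := is_ideal_pow m n.+1.
pose I : set R := [set z | exists c : 'I_#|std n| -> R,
  m^n.+1 (z - \sum_i c i * mon (exp_nat (enum_val i)))].
have mI : m^n.+1 `<=` I.
  move=> y my; exists (fun=> 0).
  by rewrite big1 ?subr0 // => i _; rewrite mul0r.
have iI : is_ideal I.
  split; first by apply: mI; exact: (ideal0 iS).
  - move=> u v [c uc] [d vd]; exists (fun i => c i + d i).
    under eq_bigr do rewrite mulrDl.
    by rewrite big_split opprD addrACA; exact: (idealD iS).
  - move=> a u [c uc]; exists (fun i => a * c i).
    under eq_bigr do rewrite -mulrA.
    by rewrite -mulr_sumr -mulrBr; exact: (idealMl iS).
suff monI f : mdeg f = n -> I (mon f).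
  move=> /ideal_pow_mon mz; apply: (smallest_ideal_ind (X := I) mz) => // _ [f fn <-].
  exact: monI.
elim: {f}_.+1 {-2}f (ltnSn (mweight f)) => [//|k IHk] f fk fn.
have fB i : (f i < B)%N by apply: leq_ltn_trans nB; rewrite -fn leq_mdeg.
pose a : expo := [ffun i => Ordinal (fB i)].
have af : exp_nat a = f by apply/funext => i; rewrite /exp_nat ffunE.
have [as_|/negP ans] := boolP (a \in std n).
  exists (fun i => (i == enum_rank_in as_ a)%:R).
  rewrite (bigD1 (enum_rank_in as_ a)) //= eqxx mul1r enum_rankK_in // af.
  rewrite big1 ?addr0 ?subrr; first exact: (ideal0 iS).
  by move=> i /negPf->; rewrite mul0r.
have /(@below_std _ _ _) bf : below n (mweight f) (mon f).
  by apply: contrapT => nb; apply: ans; apply/in_std; rewrite af.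
by apply: bf => // g gn gf; apply: IHk => //; apply: leq_trans gf _.
Qed.

Hypothesis max_m : maximal_ideal m.

Lemma inv_mod a : ~ m a -> exists b, m (1 - b * a).
Proof.
move=> nma; have [_ _ max] := max_m.
pose J : set R := [set z | exists b, m (z - b * a)].
have iJ : is_ideal J.
  split; first by exists 0; rewrite mul0r subr0; exact: (ideal0 id_m).
  - move=> u v [b ub] [c vc]; exists (b + c).
    by rewrite mulrDl opprD addrACA; exact: (idealD id_m).
  - by move=> d u [b ub]; exists (d * b); rewrite -mulrA -mulrBr; exact: (idealMl id_m).
have mJ : m `<=` J by move=> z mz; exists 0; rewrite mul0r subr0.
case: (max J iJ mJ) => JE; last by have : J 1 by rewrite JE.
by case: nma; rewrite -JE; exists 1; rewrite mul1r subrr; exact: (ideal0 id_m).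
Qed.

(** In a nontrivial relation the heaviest term has a coefficient invertible modulo [m], so its
    monomial would be a combination of lighter ones. Differences of chosen representatives of [R/m]
    satisfy the hypothesis on the coefficients. *)
Lemma std_free n (c : 'I_#|std n| -> R) :
  (forall i, c i = 0 \/ ~ m (c i)) ->
  m^n.+1 (\sum_i c i * mon (exp_nat (enum_val i))) -> forall i, c i = 0.
Proof.
move=> c0 sum_c i0; apply/eqP/negPn/negP => ci0.
have iS := is_ideal_pow m n.+1.
pose w i := mweight (exp_nat (@enum_val _ (mem (std n)) i)).
have [i ci imax] := @arg_maxnP _ i0 (fun i => c i != 0) w ci0.
have [/eqP|nmi] := c0 i; first by rewrite (negPf ci).
have /in_std[deg_i nb] : enum_val i \in std n by exact: enum_valP.
apply: nb; rewrite -/(w i); set M := mon _.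
have [b mb] := inv_mod nmi.
have iL : is_ideal (below n (w i)) by exact: smallest_ideal.
have mL : m^n.+1 `<=` below n (w i).
  by move=> y my; apply: sub_gen_smallest; right.
have -> : M = (1 - b * c i) * M + b * (c i * M) by rewrite mulrBl mul1r mulrA subrK.
apply: (idealD iL); first apply: mL.
  apply: (@ideal_powD 1); first by apply/ideal_pow1.
  by rewrite -deg_i; exact: mon_in.
apply: (idealMl iL).
rewrite (bigD1 i) //= -/M in sum_c.
have -> : c i * M = (c i * M + \sum_(j < #|std n| | j != i)
    c j * mon (exp_nat (enum_val j))) - \sum_(j < #|std n| | j != i)
    c j * mon (exp_nat (enum_val j)) by rewrite addrK.
apply: (idealB iL); first exact: mL.
apply: (ideal_sum iL) => j ji.
have [->|cj] := eqVneq (c j) 0; first by rewrite mul0r; exact: (ideal0 iL).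
apply: (idealMl iL); apply: sub_gen_smallest; left.
exists (exp_nat (enum_val j)) => //=.
have /in_std[deg_j _] : enum_val j \in std n by exact: enum_valP.
split => //; rewrite ltn_neqAle; apply/andP; split; last exact: imax.
by apply/eqP => /mweight_inj /enum_val_inj jiE; rewrite jiE eqxx in ji.
Qed.

Hypothesis fin_residue : finite_set (range (residue 1)).

(** A class modulo [m^(n+1)] is in exactly one way a representative modulo [m^n] plus a combination
    of standard monomials with coefficients among representatives modulo [m]. *)
Lemma quot_cardS n : (n < B)%N -> finite_set (range (residue n)) ->
  finite_set (range (residue n.+1)) /\
  quot_card n.+1 = (quot_card n * quot_card 1 ^ #|std n|)%N.
Proof.
move=> nB fin_n.
have iM k : is_ideal (ideal_pow m k) by exact: is_ideal_pow.
have [g [_ gI gS]] := nclasses_enum fin_n.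
have [t [_ tI tS]] := nclasses_enum fin_residue.
pose Mon i := mon (exp_nat (@enum_val _ (mem (std n)) i)).
have MonP i : m^n (Mon i).
  have /in_std[dn _] : enum_val i \in std n by exact: enum_valP.
  by have := mon_in (exp_nat (enum_val i)); rewrite dn.
pose J : finType := ('I_(quot_card n) * {ffun 'I_#|std n| -> 'I_(quot_card 1)})%type.
have cardJ : #|J| = (quot_card n * quot_card 1 ^ #|std n|)%N.
  by rewrite card_prod card_ffun !card_ord.
pose F (j : J) : R := g j.1 + \sum_i t (j.2 i) * Mon i.
have FI j k : residue n.+1 (F j) = residue n.+1 (F k) -> j = k.
  move=> /residueP jk.
  have sumM u : m^n (\sum_i t (u i) * Mon i).
    by apply: (ideal_sum (iM n)) => i _; exact: (idealMl (iM n)).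
  have j1 : j.1 = k.1.
    apply: gI; apply/residueP.
    have : m^n (F j - F k) by exact: ideal_powS.
    rewrite /F opprD addrACA => h.
    have := idealB (iM n) h (idealB (iM n) (sumM j.2) (sumM k.2)).
    by rewrite addrK.
  case: j k jk j1 => [a u] [b v] /= jk ab; rewrite {}ab /= in jk *.
  congr (_, _); apply/ffunP => i.
  have := @std_free n (fun i => t (u i) - t (v i)).
  have -> : (\sum_i (t (u i) - t (v i)) * mon (exp_nat (enum_val i)) =
    F (b, u) - F (b, v))%R.
    rewrite /F /= opprD addrACA subrr add0r -sumrB.
    by apply: eq_bigr => l _; rewrite mulrBl.
  move=> /(_ _ jk i) tuv; apply: (tI); rewrite (subr0_eq (tuv _)) // => l.
  have [/tI->|ne] := pselect (residue 1 (t (u l)) = residue 1 (t (v l))).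
    by left; rewrite subrr.
  by right=> /ideal_pow1 /residueP.
have FS z : exists j, residue n.+1 z = residue n.+1 (F j).
  have [a /residueP za] := gS z I.
  have [c zc] := std_span nB za.
  have /choice[u uP] i : exists k, residue 1 (c i) = residue 1 (t k).
    exact: tS.
  exists (a, [ffun i => u i]); apply/residueP.
  pose z' := g a + \sum_i c i * Mon i.
  apply: (idealB_trans (iM _) (y := z')).
    by rewrite /z' opprD addrA.
  rewrite /z' /F [fst _]/= opprD addrACA subrr add0r -sumrB.
  apply: (ideal_sum (iM _)) => // i _; rewrite ffunE -mulrBl.
  apply: (@ideal_powD 1) => //; by apply/residueP.
have fin : finite_set (range (residue n.+1)).
  have /choice[h hP] := FS.
  by apply: (@finite_nclasses _ _ _ J _ h) => y z _ _ yz; rewrite hP yz -hP.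
split=> //; rewrite -cardJ; apply/eqP; rewrite eqn_leq; apply/andP; split.
  have /choice[h hP] := FS.
  by apply: (nclasses_leq (h := h)) => // y z _ _ yz; rewrite hP yz -hP.
exact: (leq_nclasses (h := F)).
Qed.

(* Divisors of standard monomials are standard. Count the pairs of a standard
   monomial of degree [n + 1] and a variable, weighted by the exponent of the
   variable in the monomial. *)
Lemma std_double_count n : (n.+1 < B)%N ->
  (n.+1 * #|std n.+1| <= (n + r) * #|std n|)%N.
Proof.
move=> nB; rewrite mulnC [leqRHS]mulnC.
have -> : (#|std n.+1| * n.+1 = \sum_(i < r) \sum_(a in std n.+1) a i)%N.
  rewrite exchange_big /= -sum_nat_const; apply: eq_bigr => a.
  by move=> /in_std[<- _].
have -> : (#|std n| * (n + r) = \sum_(i < r) \sum_(a in std n) (a i).+1)%N.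
  rewrite exchange_big /= -sum_nat_const; apply: eq_bigr => a /in_std[<- _].
  rewrite -[X in (_ + X)%N]card_ord -sum1_card -big_split /=.
  by apply: eq_bigr => i _; rewrite addn1.
apply: leq_sum => i _.
pose dec (a : expo) : expo := [ffun j => if j == i then
  Ordinal (leq_ltn_trans (leq_pred (a j)) (ltn_ord (a j))) else a j].
have decE (a : expo) : (0 < a i)%N -> minc i (exp_nat (dec a)) = exp_nat a.
  move=> ai; apply/funext => j; rewrite /minc /exp_nat ffunE eq_sym.
  by case: eqVneq => [->|_] //=; rewrite add1n prednK.
pose X := [set a in std n.+1 | (0 < a i)%N].
rewrite (bigID (fun a : expo => (0 < a i)%N)) /= [X in (_ + X)%N]big1 ?addn0; last first.
  by move=> a /andP[_]; rewrite -eqn0Ngt => /eqP.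
rewrite (eq_bigl (mem X)); last by move=> a; rewrite !inE.
have decI : {in X &, injective dec}.
  move=> a b; rewrite !inE => /andP[_ ai] /andP[_ bi] ab.
  apply/ffunP => j; apply/val_inj.
  by have := congr1 (fun h => h j) (decE a ai); rewrite ab decE.
have XE : (\sum_(a in X) a i = \sum_(b in dec @: X) (b i).+1)%N.
  rewrite big_imset //=; apply: eq_bigr => a; rewrite !inE => /andP[_ ai].
  by rewrite ffunE eqxx /= prednK.
rewrite XE; have sub : dec @: X \subset std n.
  apply/fintype.subsetP => _ /imsetP[a + ->]; rewrite inE => /andP[/in_std[da nb] ai].
  have dE := decE a ai; apply/in_std; split.
    by move: da; rewrite -dE mdeg_inc => -[].
  move=> b; apply: nb; rewrite -dE mweight_inc mon_inc; exact: below_mul.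
by rewrite [leqRHS](big_setID (dec @: X)) /= (finset.setIidPr sub) leq_addr.
Qed.

End Monomials.
End IdealPowers.

(** * Slow growth from the Hilbert function inequality *)

Section SlowGrowth.
Variables (h : nat -> nat) (r : nat).
Hypothesis h_le : forall n, (n.+1 * h n.+1 <= (n + r) * h n)%N.
Let a n := (\sum_(i < n) h i)%N.

Lemma ratio_le n l : (0 < n)%N -> (n <= l)%N -> (n * h l.+1 <= (n + r) * h l)%N.
Proof.
move=> n0 nl; rewrite -(leq_pmul2l (ltn0Sn l)).
have := h_le l; rewrite -(leq_pmul2l n0) => hl.
nia.
Qed.

(** This is [(1 + r/n)^j <= 1 + 2rj/n]: under [2rj <= n] the factor 2 absorbs the quadratic term
    that appears at each step. *)
Lemma ratio_iter n j : (0 < n)%N -> (2 * r * j <= n)%N ->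
  (n * h (n + j) <= (n + 2 * r * j) * h n)%N.
Proof.
move=> n0; elim: j => [|j IHj] jn; first by rewrite muln0 !addn0.
have {}IHj : (n * h (n + j) <= (n + 2 * r * j) * h n)%N by apply: IHj; lia.
have st := ratio_le n0 (leq_addr j n).
rewrite addnS -(leq_pmul2l n0).
apply: leq_trans (_ : (n + r) * (n * h (n + j)) <= _)%N; first by nia.
apply: leq_trans (_ : (n + r) * ((n + 2 * r * j) * h n) <= _)%N.
  by rewrite leq_mul2l IHj orbT.
rewrite !mulnA leq_mul2r; apply/orP; right; nia.
Qed.

Lemma ratio_le2 n j : (0 < n)%N -> (2 * r * j <= n)%N -> (h (n + j) <= 2 * h n)%N.
Proof.
move=> n0 jn; have := ratio_iter n0 jn => hj.
rewrite -(leq_pmul2l n0); apply: leq_trans hj _; nia.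
Qed.

(** For [j < k], [h (n + j)] is at most twice each of the [L] values just before index [n], so
    [L * h (n + j) <= 2 * a n]. Summed over [j] with [L = 2kM], this bounds the increment of [a] by
    [a n / M]. *)
Lemma sum_slow_growth k M : exists n0, forall n, (n0 <= n)%N ->
  (M * a (n + k) <= M.+1 * a n)%N.
Proof.
have [->|k0] := posnP k.
  by exists 0%N => n _; rewrite addn0 leq_mul2r leqnSn orbT.
pose L := (2 * k * M)%N.
(* Every [i >= n - L] is then positive and at least [2r(L + k)], as [ratio_le2] requires for the
   distance [n + j - i]. *)
exists (L + 2 * r * (L + k) + 1)%N => n nn.
have step j : (j < k)%N -> (L * h (n + j) <= 2 * a n)%N.
  move=> jk; rewrite /a -(big_mkord xpredT) (@big_cat_nat _ _ _ (n - L)%N) //=; last lia.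
  rewrite mulnDr; apply: leq_trans (leq_addl _ _).
  rewrite big_distrr /=.
  have -> : (L * h (n + j) = \sum_(n - L <= i < n) h (n + j))%N.
    by rewrite sum_nat_const_nat; congr (_ * _)%N; lia.
  rewrite !big_nat; apply: leq_sum => i /andP[i1 i2].
  have -> : (n + j = i + (n + j - i))%N by lia.
  apply: ratio_le2; first lia.
  apply: leq_trans (_ : 2 * r * (L + k) <= _)%N; last lia.
  by rewrite leq_mul2l; apply/orP; right; lia.
have aD : (a (n + k) = a n + \sum_(j < k) h (n + j))%N.
  by rewrite /a big_split_ord.
rewrite aD mulnDr mulSn addnC leq_add2r.
rewrite -(@leq_pmul2l (2 * k)) ?muln_gt0 //.
apply: leq_trans (_ : \sum_(j < k) (2 * a n) <= _)%N.
  rewrite mulnA -/L big_distrr /=; apply: leq_sum => j _; exact: step.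
by rewrite sum_nat_const card_ord mulnA [(k * 2)%N]mulnC.
Qed.

End SlowGrowth.

(** * Growth of the cardinals of the quotients R/m^n *)

Section QuotientGrowth.
Variables (R : idomainType) (p : nat) (m : set R).
Hypothesis hR : pro_p_ring p m.
Local Notation "m^ n" := (ideal_pow m n) (at level 2, n at level 1, format "m^ n").

Lemma pro_p_ideal : is_ideal m.
Proof. by have [] := pro_p_maximal hR. Qed.

Lemma pro_p_proper : ~ m 1.
Proof.
have [iM mT _] := pro_p_maximal hR => m1; apply: mT; apply/seteqP; split=> // x _.
by rewrite -[x]mulr1; exact: (idealMl iM).
Qed.

Lemma pro_p_separated x : (forall n, m^n x) -> x = 0.
Proof. by have [+ _] := pro_p_complete hR; apply. Qed.

Lemma pro_p_finite_residue : finite_set (range (residue m 1)).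
Proof.
suff -> : residue m 1 = (fun x => [set y | m (y - x)]).
  exact: pro_p_residue_finite hR.
by apply/funext => x; apply/seteqP; split=> y /= /(ideal_pow1 pro_p_ideal).
Qed.

Lemma pro_p_gens : exists (r : nat) (x : 'I_r -> R),
  m = smallest (@is_ideal R) (range x).
Proof.
have [s ms] := pro_p_noetherian hR pro_p_ideal.
exists (size s), (fun i => s`_i); rewrite ms; congr smallest.
apply/seteqP; split=> [y /= ys|_ [i _ <-]] /=; last exact: mem_nth.
by exists (Ordinal (etrans (index_mem y s) ys)) => //=; rewrite nth_index.
Qed.

Lemma quot_card0 : finite_set (range (residue m 0)) /\ quot_card m 0 = 1%N.
Proof.
have e x y : [set: R] x -> [set: R] y -> tt = tt -> residue m 0 x = residue m 0 y.
  by move=> _ _ _; apply/residueP.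
have fin := @finite_nclasses _ _ (residue m 0) unit [set: R] (fun=> tt) e.
split=> //; apply/eqP; rewrite eqn_leq nclasses_gt0 //; last by exists 0.
by rewrite -card_unit (nclasses_leq (h := fun=> tt)).
Qed.

Lemma quot_card1_gt1 : (1 < quot_card m 1)%N.
Proof.
rewrite -card_bool; apply: (leq_nclasses (h := fun b : bool => b%:R)) => //.
  exact: pro_p_finite_residue.
have n1 : ~ m^1 1 by move=> /(ideal_pow1 pro_p_ideal); exact: pro_p_proper.
have n1' : ~ m^1 (-1).
  by move=> /(idealN (is_ideal_pow m 1)); rewrite opprK.
by move=> [] [] //= /residueP; rewrite ?subr0 ?sub0r.
Qed.

(** Here [a n] is the length of [R/m^n]. The nonzero [x] in [m] excludes a finite field, for which
    [a] would be bounded. *)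
Lemma quot_card_growth x : x != 0 -> m x -> exists a : nat -> nat,
  [/\ forall n, finite_set (range (residue m n)),
      forall n, quot_card m n = (quot_card m 1 ^ a n)%N,
      forall n, (n <= a n)%N
    & forall k M, exists n0, forall n, (n0 <= n)%N ->
        (M * a (n + k) <= M.+1 * a n)%N].
Proof.
move=> x0 mx; have [r [t mt]] := pro_p_gens.
have mon_m := pro_p_maximal hR; have id_m := pro_p_ideal.
have q1 := quot_card1_gt1.
pose h n := #|std m t n.+1 n|.
have S n B := @quot_cardS R m id_m r t mt B mon_m pro_p_finite_residue n.
have fin n : finite_set (range (residue m n)).
  elim: n => [|n IHn]; first by case: quot_card0.
  by have [] := S n n.+1 (ltnSn n) IHn.
have qS n : quot_card m n.+1 = (quot_card m n * quot_card m 1 ^ h n)%N.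
  by have [] := S n n.+1 (ltnSn n) (fin n).
have Qgt0 n : (0 < quot_card m n)%N by apply: nclasses_gt0 => //; exists 0.
(* The standard monomials may depend on [B], but their number is the exponent of [|R/m|] in the
   index of [m^(n+1)] in [m^n]. Consecutive degrees can thus be compared in a common base. *)
have hB n B : (n < B)%N -> #|std m t B n| = h n.
  move=> nB; have [_] := S n B nB (fin n); rewrite qS => /eqP.
  by rewrite eqn_pmul2l // eqn_exp2l // => /eqP.
have h_le n : (n.+1 * h n.+1 <= (n + r) * h n)%N.
  by rewrite -(hB n n.+2) // std_double_count.
(* Otherwise [m^n] is contained in all later powers, and [x ^+ n] vanishes by separatedness. *)
have h_gt0 n : (0 < h n)%N.
  rewrite lt0n; apply/eqP => h0.
  have mm : m^n `<=` m^n.+1.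
    move=> z /(std_span mt (ltnSn n))[c].
    rewrite big1 ?subr0 // => i; have := ltn_ord i.
    by rewrite [X in (_ < X)%N]h0.
  have mall k : m^n `<=` m^(n + k).
    elim: k => [|k IHk]; first by rewrite addn0.
    move=> z /mm mz; rewrite addnS.
    move: mz => /= mz; apply: (smallest_ideal_ind mz).
      exact: (is_ideal_pow m (n + k).+1).
    move=> _ [u mu [v /IHk mv <-]].
    by apply: (@ideal_powD _ m 1) => //; apply/ideal_pow1.
  have : x ^+ n = 0.
    apply: pro_p_separated => k; apply: (@ideal_pow_le _ m _ (n + k)).
      exact: leq_addl.
    apply: mall; have := @ideal_powX _ m 1 n x; rewrite muln1; apply.
    by apply/ideal_pow1.
  by move=> /eqP; rewrite expf_eq0 (negPf x0) andbF.
exists (fun n => \sum_(i < n) h i)%N; split=> //.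
- elim=> [|n IHn]; first by rewrite big_ord0 expn0; case: quot_card0.
  by rewrite qS IHn -expnD big_ord_recr.
- move=> n; rewrite -[leqLHS]card_ord -sum1_card; apply: leq_sum => i _.
  exact: h_gt0.
- exact: sum_slow_growth.
Qed.

End QuotientGrowth.

(** * The adic absolute value and convergent power series *)

Lemma fraction_repr (R : idomainType) (z : {fraction R}) :
  z = tofrac (frac (repr z)).1 / tofrac (frac (repr z)).2.
Proof.
apply: (canRL (mulfK _)); first by rewrite tofrac_eq0 denom_ratioP.
rewrite -[X in X * _]reprK; unlock tofrac.
rewrite -[LHS]FracField.pi_mul; apply/eqmodP.
rewrite /= FracField.equivfE /FracField.mulf /=.
rewrite !numden_Ratio ?oner_eq0 ?mulr1 ?denom_ratioP //.
by rewrite mulrC.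
Qed.

Section AdicAbsoluteValue.
Variables (RR : realType) (c : RR) (c_gt1 : 1 < c).
Variables (R : idomainType) (p : nat) (m : set R) (hR : pro_p_ring p m).
Local Notation "m^ n" := (ideal_pow m n) (at level 2, n at level 1, format "m^ n").
Local Notation K := {fraction R}.
Local Notation ord := (adic_ord m).
Local Notation absR := (adic_abs c m).
Local Notation absK := (fraction_abs c m).

Lemma adic_ordP x : x != 0 -> m^(ord x) x /\ ~ m^(ord x).+1 x.
Proof.
move=> x0; rewrite /adic_ord; case: xgetP => [n _ [//]|no].
exfalso; move/eqP: x0; apply; apply: (pro_p_separated hR).
by elim=> [//|n IHn]; apply: contrapT => mn; apply: (no n).
Qed.

Lemma leq_adic_ord x n : x != 0 -> m^n x <-> (n <= ord x)%N.
Proof.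
move=> /adic_ordP[xm xnm]; split=> [mx|nx]; last exact: ideal_pow_le xm.
by rewrite leqNgt; apply/negP => xn; apply: xnm; exact: ideal_pow_le mx.
Qed.

(** The monomials [x *: 'X^(ord x)] and [y *: 'X^(ord y)] represent the initial forms of [x] and
    [y]; if the order of [x * y] exceeded the sum, these forms would be zero divisors in the graded
    ring. *)
Lemma adic_ordM x y : x != 0 -> y != 0 -> ord (x * y) = (ord x + ord y)%N.
Proof.
move=> x0 y0; have [xm nxm] := adic_ordP x0; have [ym nym] := adic_ordP y0.
have xy0 : x * y != 0 by rewrite mulf_neq0.
apply/eqP; rewrite eqn_leq; apply/andP; split; last first.
  by apply/leq_adic_ord => //; exact: ideal_powD.
have I0 n : m^n 0 by exact: (ideal0 (is_ideal_pow m n)).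
rewrite leqNgt; apply/negP => /(leq_adic_ord _ xy0) mxy.
have [_ /(_ (x *: 'X^(ord x)) (y *: 'X^(ord y)))] := pro_p_graded hR.
have repr a : a != 0 -> gr_repr m (a *: 'X^(ord a)).
  move=> a0 n; rewrite coefZ coefXn; case: eqP => [->|_]; last by rewrite mulr0.
  by rewrite mulr1; have [] := adic_ordP a0.
have nzero a : a != 0 -> ~ gr_zero m (a *: 'X^(ord a)).
  move=> a0 /(_ (ord a)); rewrite coefZ coefXn eqxx mulr1.
  by have [] := adic_ordP a0.
move=> /(_ (repr _ x0) (repr _ y0)) []; [|exact: nzero..].
move=> n; rewrite -scalerAl -scalerAr scalerA -exprD coefZ coefXn.
by case: eqP => [->|_]; [rewrite mulr1|rewrite mulr0; exact: I0].
Qed.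

Lemma adic_ord1 : ord 1 = 0%N.
Proof.
have := adic_ordM (oner_neq0 R) (oner_neq0 R).
by rewrite mulr1 -[LHS]addn0 => /addnI.
Qed.

Lemma adic_ordX x n : x != 0 -> ord (x ^+ n) = (n * ord x)%N.
Proof.
move=> x0; elim: n => [|n IHn]; first by rewrite expr0 adic_ord1.
by rewrite exprS adic_ordM ?expf_neq0 // IHn mulSn.
Qed.

Let c_gt0 : 0 < c. Proof. exact: lt_trans c_gt1. Qed.

Lemma adic_abs0 : absR 0 = 0.
Proof. by rewrite /adic_abs eqxx. Qed.

Lemma adic_absE x : x != 0 -> absR x = c ^- ord x.
Proof. by move=> x0; rewrite /adic_abs (negPf x0). Qed.

Lemma adic_abs_gt0 x : x != 0 -> 0 < absR x.
Proof. by move=> /adic_absE->; rewrite invr_gt0 exprn_gt0. Qed.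

Lemma adic_abs_ge0 x : 0 <= absR x.
Proof.
by have [->|/adic_abs_gt0/ltW//] := eqVneq x 0; rewrite adic_abs0.
Qed.

Lemma adic_absM x y : absR (x * y) = absR x * absR y.
Proof.
have [->|x0] := eqVneq x 0; first by rewrite mul0r adic_abs0 mul0r.
have [->|y0] := eqVneq y 0; first by rewrite mulr0 adic_abs0 mulr0.
by rewrite !adic_absE ?mulf_neq0 // adic_ordM // exprD invfM.
Qed.

Lemma adic_abs_le x n : absR x <= c ^- n <-> m^n x.
Proof.
have [->|x0] := eqVneq x 0.
  by rewrite adic_abs0 invr_ge0 exprn_ge0 ?ltW //; split=> // _;
    exact: (ideal0 (is_ideal_pow m n)).
rewrite adic_absE // lef_pV2 ?posrE ?exprn_gt0 // ler_eXn2l //.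
by split=> /(leq_adic_ord _ x0).
Qed.

Lemma adic_absN x : absR (- x) = absR x.
Proof.
have [->|x0] := eqVneq x 0; first by rewrite oppr0.
have Nx0 : - x != 0 by rewrite oppr_eq0.
have iN n y : m^n y -> m^n (- y) by exact: (idealN (is_ideal_pow m n)).
apply/eqP; rewrite eq_le; apply/andP; split.
  rewrite [leRHS]adic_absE //; apply/adic_abs_le; apply: iN.
  by have [] := adic_ordP x0.
rewrite [leRHS]adic_absE //; apply/adic_abs_le; rewrite -[x]opprK.
by apply: iN; rewrite opprK; have [] := adic_ordP Nx0.
Qed.

Lemma adic_absD_le x y a : absR x <= a -> absR y <= a -> absR (x + y) <= a.
Proof.
wlog xy : x y / absR x <= absR y => [hw|].
  have [xy|/ltW yx] := lerP (absR x) (absR y); first exact: hw.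
  by move=> xa ya; rewrite addrC; exact: hw.
move=> _; apply: le_trans.
have [y0|y0] := eqVneq y 0.
  by move: xy; rewrite y0 addr0.
rewrite [leRHS]adic_absE //; apply/adic_abs_le.
by apply: (idealD (is_ideal_pow m _)); apply/adic_abs_le; rewrite -adic_absE.
Qed.

Lemma fraction_numden (z : K) : exists a b, b != 0 /\ z = tofrac a / tofrac b /\
  absK z = absR a / absR b.
Proof.
exists (frac (repr z)).1, (frac (repr z)).2; split; first exact: denom_ratioP.
by split=> //; exact: fraction_repr.
Qed.

(** Multiplicativity makes the value independent of the representative chosen by [repr]. *)
Lemma fraction_abs_frac a b : b != 0 ->
  absK (tofrac a / tofrac b) = absR a / absR b.
Proof.
move=> b0; have [a' [b' [b'0 [e ->]]]] := fraction_numden (tofrac a / tofrac b).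
have /eqP : a * b' = a' * b.
  apply/eqP; rewrite -tofrac_eq !tofracM -eqr_div ?tofrac_eq0 //.
  by rewrite e.
move=> /eqP/(congr1 absR); rewrite !adic_absM => ab.
by apply/eqP; rewrite eqr_div ?lt0r_neq0 ?adic_abs_gt0 // ab.
Qed.

Lemma fraction_abs_tofrac a : absK (tofrac a) = absR a.
Proof.
have := fraction_abs_frac a (oner_neq0 R); rewrite tofrac1 !divr1 => ->.
by rewrite [X in _ / X]adic_absE ?oner_neq0 // adic_ord1 expr0 invr1 divr1.
Qed.

Lemma fraction_absM y z : absK (y * z) = absK y * absK z.
Proof.
have [a [b [b0 [-> ->]]]] := fraction_numden y.
have [a' [b' [b'0 [-> ->]]]] := fraction_numden z.
rewrite mulf_div -!tofracM fraction_abs_frac ?mulf_neq0 // !adic_absM.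
by rewrite mulf_div.
Qed.

Lemma fraction_abs_ge0 z : 0 <= absK z.
Proof.
by have [a [b [b0 [_ ->]]]] := fraction_numden z; rewrite divr_ge0 // adic_abs_ge0.
Qed.

Lemma fraction_absN z : absK (- z) = absK z.
Proof.
by rewrite -mulN1r -tofrac1 -tofracN fraction_absM fraction_abs_tofrac adic_absN
  -fraction_abs_tofrac -fraction_absM tofrac1 mul1r.
Qed.

Lemma fraction_absD_le y z a : absK y <= a -> absK z <= a -> absK (y + z) <= a.
Proof.
have [s [t [t0 [-> _]]]] := fraction_numden y.
have [s' [t' [t'0 [-> _]]]] := fraction_numden z.
rewrite addf_div ?tofrac_eq0 // -!tofracM -tofracD.
rewrite !fraction_abs_frac ?mulf_neq0 //.
rewrite !ler_pdivrMr ?adic_abs_gt0 ?mulf_neq0 // => sa s'a.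
apply: adic_absD_le.
  by rewrite !adic_absM mulrA ler_wpM2r // adic_abs_ge0.
by rewrite !adic_absM [absR t * _]mulrC mulrA ler_wpM2r ?adic_abs_ge0.
Qed.

Lemma fraction_absB_le y z a : absK y <= a -> absK z <= a -> absK (y - z) <= a.
Proof. by move=> ya za; apply: fraction_absD_le => //; rewrite fraction_absN. Qed.

Lemma fraction_abs_sum_le (I : Type) (r : seq I) (F : I -> K) a : 0 <= a ->
  (forall i, absK (F i) <= a) -> absK (\sum_(i <- r) F i) <= a.
Proof.
move=> a0 Fa; apply: (big_ind (fun z => absK z <= a)) => //.
  by rewrite -tofrac0 fraction_abs_tofrac adic_abs0.
by move=> y z; exact: fraction_absD_le.
Qed.

Section Sums.
Variable I : choiceType.
Implicit Types a b : I -> K.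

Lemma sums_toB a b s t : sums_to c m a s -> sums_to c m b t ->
  sums_to c m (fun i => a i - b i) (s - t).
Proof.
(* The ultrametric inequality costs no factor; halving serves to recover a strict bound from a large
   one. *)
move=> as_ bt eps eps0; have e2 : 0 < eps / 2 by rewrite divr_gt0.
have [A HA] := as_ _ e2; have [B HB] := bt _ e2.
exists (A `|` B)%fset => C; rewrite fsubUset => /andP[/HA AC /HB BC].
rewrite (_ : s - t - _ = (s - \sum_(i <- C) a i) - (t - \sum_(i <- C) b i));
  last by rewrite sumrB; ring.
have := @fraction_absB_le _ _ (eps / 2) (ltW AC) (ltW BC).
move=> /le_lt_trans; apply.
by rewrite ltr_pdivrMr // mulr_natr mulr2n ltrDl.
Qed.

Lemma sums_to_le a s M : 0 <= M -> (forall i, absK (a i) <= M) ->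
  sums_to c m a s -> absK s <= M.
Proof.
move=> M0 aM as_; apply/ler_addgt0Pr => eps eps0.
have [A /(_ A (fsubset_refl A)) /ltW sA] := as_ _ eps0.
rewrite -(subrK (\sum_(i <- A) a i) s); apply: fraction_absD_le.
  by apply: le_trans sA _; rewrite lerDr.
by apply: le_trans (fraction_abs_sum_le _ M0 aM) _; rewrite lerDl ltW.
Qed.

Lemma exp_unbounded x : exists k, x <= c ^+ k.
Proof.
have c1 : 0 < c - 1 by rewrite subr_gt0.
have lin k : k%:R * (c - 1) <= c ^+ k.
  elim: k => [|k IHk]; first by rewrite mul0r expr0 ler01.
  have : c - 1 <= c ^+ k * (c - 1).
    by apply: ler_peMl; [exact: ltW|exact/exprn_ege1/ltW].
  rewrite exprSr mulrBr mulr1 -[k.+1]addn1 natrD mulrDl mul1r; lra.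
have [x0|x0] := lerP x 0; first by exists 0%N; rewrite expr0; lra.
exists (Num.bound (x / (c - 1))); apply: le_trans (lin _).
rewrite -ler_pdivrMr //; apply/ltW/archi_boundP.
by apply: divr_ge0; exact: ltW.
Qed.

(** A term outside [A] is the difference of two partial sums within 1 of [s]; the finitely many
    terms in [A] are bounded by the sum of their absolute values. *)
Lemma sums_to_bounded a s : sums_to c m a s ->
  exists k, forall i, absK (a i) <= c ^+ k.
Proof.
move=> /(_ 1 ltr01)[A HA].
have [k hk] := exp_unbounded (1 + \sum_(i <- A) absK (a i)).
exists k => i; apply: le_trans hk.
have S0 : 0 <= \sum_(i <- A) absK (a i).
  by apply: sumr_ge0 => j _; exact: fraction_abs_ge0.
have [iA|iA] := boolP (i \in A).
  rewrite (big_fsetD1 i) //= addrCA lerDl addr_ge0 //.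
  by apply: sumr_ge0 => j _; exact: fraction_abs_ge0.
apply: (@le_trans _ _ 1); last by rewrite lerDl.
have -> : a i = (s - \sum_(j <- A) a j) - (s - \sum_(j <- (i |` A)%fset) a j).
  by rewrite big_fsetU1 //=; ring.
by apply: fraction_absB_le; apply/ltW/HA => //; exact: fsubsetU1.
Qed.

End Sums.

Lemma sums_to_abs_le_pow (I : choiceType) (a : I -> K) s n :
  (forall i, absK (a i) <= c ^- n) -> sums_to c m a (tofrac s) -> m^n s.
Proof.
move=> an /(sums_to_le _ an) h; apply/adic_abs_le; rewrite -fraction_abs_tofrac.
by apply: h; rewrite invr_ge0 exprn_ge0 // ltW.
Qed.

(** * Local Lipschitz estimate for analytic maps *)

Section Lipschitz.
Variable pi : R.
Hypotheses (pi_neq0 : pi != 0) (m_pi : m pi).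

(** Closeness relative to the size [m^l]. It passes to products with the same [n] while the sizes
    add up, so monomials of every degree are handled uniformly. *)
Let close n l (x y : R) := [/\ m^l x, m^l y & m^(n + l) (x - y)].

Lemma close1 n : close n 0 1 1.
Proof. by split=> //; rewrite subrr; exact: (ideal0 (is_ideal_pow m _)). Qed.

Lemma closeM n l l' x y x' y' : close n l x y -> close n l' x' y' ->
  close n (l + l') (x * x') (y * y').
Proof.
move=> [xl yl xy] [xl' yl' xy']; split; [exact: ideal_powD..|].
have -> : x * x' - y * y' = (x - y) * x' + y * (x' - y') by ring.
have iM := is_ideal_pow m (n + (l + l')).
apply: (idealD iM); first by rewrite addnA; exact: ideal_powD.
by rewrite addnCA; exact: ideal_powD.
Qed.

Lemma close_monomial n l r (alpha : 'I_r -> nat) (u v : 'I_r -> R) :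
  (forall i, close n l (u i) (v i)) ->
  close n (\sum_i alpha i * l)%N (\prod_i u i ^+ alpha i) (\prod_i v i ^+ alpha i).
Proof.
move=> uv; elim/big_rec3: _ => [|i L y z _ IH]; first exact: close1.
apply: closeM => //; elim: (alpha i) => [|k IHk]; first exact: close1.
by rewrite !exprS mulSn; exact: closeM.
Qed.

Lemma analytic_lipschitz r s (V : set (adic m r)) (f : adic m r -> adic m s) y :
  analytic_on c V f -> V y -> exists l k, forall x x',
    ideal_powV m l (x - y) -> ideal_powV m l (x' - y) ->
    [/\ V x, V x' & forall n, ideal_powV m (n + k) (x - x') ->
      ideal_powV m n (f x - f x')].
Proof.
move=> /[apply] -[l0 [F HF]].
pose t := pi ^+ l0; have t0 : t != 0 by rewrite expf_neq0.
have mt : m^l0 t.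
  have := @ideal_powX _ m 1 l0 pi; rewrite muln1; apply.
  by apply/ideal_pow1 => //; exact: pro_p_ideal hR.
pose l := ord t.
have l0l : (l0 <= l)%N by apply/leq_adic_ord.
(* A Cauchy estimate: the series converges at [y + (t, ..., t)], so its terms there are bounded, and
   each monomial takes the value [t] to the total degree. *)
have /choice[K_ HK] (i : 'I_s) : exists k, forall al : exponent r,
    absK (F i al) <= c ^+ k * c ^+ (\sum_j al j * l).
  have [|_ /(_ i) Fi] := HF (y + (const_mx t : 'rV_r)).
    by rewrite addrC addKr => j; rewrite mxE.
  have [k hk] := sums_to_bounded Fi; exists k => al; have := hk al.
  rewrite addrC addKr fraction_absM.
  have -> : \prod_(j < r) tofrac ((const_mx t : 'rV[R]_r) ord0 j) ^+ al j =
      tofrac (t ^+ (\sum_j al j)).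
    rewrite -prodrXr rmorph_prod; apply: eq_bigr => j _.
    by rewrite mxE rmorphXn.
  rewrite fraction_abs_tofrac -ler_pdivlMr; last first.
    by apply: adic_abs_gt0; exact: expf_neq0.
  congr (_ <= _); congr (_ * _).
  rewrite adic_absE ?expf_neq0 // invrK; congr (_ ^+ _).
  by rewrite adic_ordX // big_distrl.
(* [K_ i] pays for the coefficients, and [l] for the relative form of [close]. The factors depending
   on the degree of the monomial cancel. *)
exists l, (\max_i K_ i + l)%N => x x' xl xl'.
have xl0 := ideal_powV_le l0l xl; have xl0' := ideal_powV_le l0l xl'.
have [Vx sx] := HF x xl0; have [Vx' sx'] := HF x' xl0'.
split=> // n xx' i; rewrite mxE [X in _ + X]mxE.
apply: (sums_to_abs_le_pow (n := n)); last first.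
  rewrite tofracB; exact: (sums_toB (sx i) (sx' i)).
move=> al /=; rewrite -mulrBr fraction_absM.
pose u j := (x - y) ord0 j; pose v j := (x' - y) ord0 j.
have toE (w : 'rV[R]_r) : \prod_(j < r) tofrac (w ord0 j) ^+ al j =
   tofrac (\prod_(j < r) w ord0 j ^+ al j).
  by rewrite rmorph_prod; apply: eq_bigr => j _; rewrite rmorphXn.
rewrite !toE -tofracB fraction_abs_tofrac.
have [j|_ _ /adic_abs_le d] := @close_monomial (n + K_ i) l r al u v.
  split; [exact: xl|exact: xl'|].
  have -> : u j - v j = (x - x') ord0 j by rewrite /u /v !mxE; ring.
  apply: ideal_pow_le (xx' j); rewrite addnA leq_add2r leq_add2l.
  exact: leq_bigmax.
apply: le_trans (ler_pM _ _ (HK i al) d) _; rewrite ?fraction_abs_ge0 ?adic_abs_ge0 //.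
set S := (\sum_j _)%N; rewrite le_eqVlt; apply/orP; left; apply/eqP.
have c0 k : c ^+ k != 0 by rewrite expf_neq0 // lt0r_neq0.
by rewrite !exprD; field; rewrite !c0.
Qed.

End Lipschitz.

End AdicAbsoluteValue.

(** * Cosets, and the natural filtration of a standard group *)

Section Cosets.
Variables (G : groupType) (K : set G).
Hypothesis sgK : is_subgroup K.

Definition right_coset (x : G) : set G := [set (k * x)%g | k in K].

Lemma right_cosetP x y : right_coset x = right_coset y <-> K (x * y^-1)%g.
Proof.
have [K1 KM KV] := sgK; split=> [e|xy].
  have : right_coset x x by exists 1%g; rewrite ?mul1g.
  by rewrite e => -[k Kk <-]; rewrite mulgK.
apply/seteqP; split=> z [k Kk <-].
  by exists (k * (x * y^-1))%g; [exact: KM|rewrite -!mulgA mulVg mulg1].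
exists (k * (y * x^-1))%g; last by rewrite -!mulgA mulVg mulg1.
by apply: KM => //; have := KV _ xy; rewrite invgM invgK.
Qed.

Lemma right_coset_mem x y : right_coset x y <-> K (y * x^-1)%g.
Proof.
split=> [[k Kk <-]|yx]; first by rewrite mulgK.
by exists (y * x^-1)%g => //; rewrite mulgVK.
Qed.

Lemma right_coset_mulr x y z :
  right_coset (x * z)%g = right_coset (y * z)%g <-> right_coset x = right_coset y.
Proof. by rewrite !right_cosetP invgM mulgA mulgK. Qed.

End Cosets.

(* [compact_cover] is only available for pointed spaces. *)
Definition pointed_group (G : topologicalGroupType) : Type := G.
HB.instance Definition _ (G : topologicalGroupType) :=
  Topological.copy (pointed_group G) G.
HB.instance Definition _ (G : topologicalGroupType) :=
  isPointed.Build (pointed_group G) (1%g : G).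

Section TopologicalGroups.
Variable G : topologicalGroupType.

Lemma mulgr_continuous (z : G) : continuous (fun x : G => (x * z)%g).
Proof.
move=> x; apply: (@continuous_comp _ _ _ (fun x : G => (x, z)) (fun t => (t.1 * t.2)%g)).
  apply: cvg_pair => /=; [exact: cvg_id|exact: cvg_cst].
exact: mulg_continuous.
Qed.

Lemma open_right_coset (K : set G) (x : G) : open K -> open (right_coset K x).
Proof.
move=> oK; have -> : right_coset K x = (fun y : G => (y * x^-1)%g) @^-1` K.
  by apply/seteqP; split=> y /right_coset_mem.
by apply: open_comp => // y _; exact: mulgr_continuous.
Qed.

Lemma finite_right_cosets (K : set G) : compact [set: G] -> open K ->
  is_subgroup K -> finite_set (range (right_coset K)).
Proof.
move=> cG oK sgK.
have : @cover_compact (pointed_group G) [set: G] by rewrite -compact_cover.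
move=> /(_ G [set: G] (right_coset K)) [].
- by move=> x _; exact: open_right_coset.
- by move=> x _; exists x => //; exists 1%g; [case: sgK|rewrite mul1g].
move=> D _ cov; apply: (@sub_finite_set _ _ (right_coset K @` [set` D])).
  move=> _ [x _ <-]; have [y Dy yx] := cov x I; exists y => //.
  by apply/right_cosetP => //; move: yx; move=> /right_coset_mem yx;
    have [_ _ /(_ _ yx)] := sgK; rewrite invgM invgK.
by apply: finite_image; exact: finite_fset.
Qed.

(* Only the part of the closure inside [K] has to be checked, because
   [closure H] is covered by the translates of [K] by elements of [H]. *)
Lemma closed_subgroup (H K : set G) : is_subgroup H -> is_subgroup K ->
  open K -> closure H `&` K `<=` H -> closed H.
Proof.
move=> [H1 HM HV] [K1 KM KV] oK clK y clHy.
have [h [Hh /right_coset_mem Khy]] : H `&` right_coset K y !=set0.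
  apply: clHy; apply: open_nbhs_nbhs; split; first exact: open_right_coset.
  by exists 1%g; rewrite ?mul1g.
rewrite -[y](mulgVK h); apply: (HM) => //; apply: clK; split; last first.
  by have := KV _ Khy; rewrite invgM invgK.
move=> B /(mulgr_continuous (z := (h^-1)%g)) /clHy[x [Hx Bx]].
by exists (x * h^-1)%g; split=> //; apply: (HM) => //; exact: HV.
Qed.

End TopologicalGroups.

Section VectorIdealPowers.
Variables (R : idomainType) (m : set R).
Local Notation "m^ n" := (ideal_pow m n) (at level 2, n at level 1, format "m^ n").
Implicit Types n r : nat.

Lemma ideal_powV0 r n : @ideal_powV R m r n 0.
Proof. by move=> i; rewrite mxE; exact: (ideal0 (is_ideal_pow m n)). Qed.

Lemma ideal_powVD r n (x y : 'rV[R]_r) :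
  ideal_powV m n x -> ideal_powV m n y -> ideal_powV m n (x + y).
Proof. by move=> xn yn i; rewrite mxE; exact: (idealD (is_ideal_pow m n)). Qed.

Lemma ideal_powVN r n (x : 'rV[R]_r) : ideal_powV m n x -> ideal_powV m n (- x).
Proof. by move=> xn i; rewrite mxE; exact: (idealN (is_ideal_pow m n)). Qed.

Lemma ideal_powVB r n (x y : 'rV[R]_r) :
  ideal_powV m n x -> ideal_powV m n y -> ideal_powV m n (x - y).
Proof. by move=> xn /ideal_powVN; exact: ideal_powVD. Qed.

Lemma ideal_powV_mulmx r r' n (x : 'rV[R]_r) (M : 'M[R]_(r, r')) :
  ideal_powV m n x -> ideal_powV m n (x *m M).
Proof.
move=> xn i; rewrite mxE; apply: (ideal_sum (is_ideal_pow m n)) => j _.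
exact: (idealMr (is_ideal_pow m n)).
Qed.

Lemma ideal_powVZ r k n (x : 'rV[R]_r) a :
  m^k a -> ideal_powV m n x -> ideal_powV m (k + n) (a *: x).
Proof. by move=> ak xn i; rewrite mxE; exact: ideal_powD. Qed.

Lemma ideal_pow_monomial n r (alpha : 'I_r -> nat) (u : 'I_r -> R) i :
  (forall i, m^n (u i)) -> (0 < alpha i)%N -> m^n (\prod_j u j ^+ alpha j).
Proof.
move=> un ai; rewrite (bigD1 i) //= -(prednK ai) exprS -mulrA.
exact: (idealMr (is_ideal_pow m n)).
Qed.

Lemma prod0_pow r (alpha : 'I_r -> nat) i : (0 < alpha i)%N ->
  \prod_j (0 : R) ^+ alpha j = 0.
Proof. by move=> ai; rewrite (bigD1 i) //= expr0n gtn_eqF // mul0r. Qed.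

Lemma prod_pow0 r (alpha : 'I_r -> nat) (u : 'I_r -> R) :
  (forall i, alpha i = 0%N) -> \prod_j u j ^+ alpha j = 1.
Proof. by move=> a0; apply: big1 => j _; rewrite a0 expr0. Qed.

End VectorIdealPowers.

(** * Standard groups: multiplication is addition to first order *)

Section StandardGroup.
Variables (RR : realType) (c : RR) (c_gt1 : 1 < c).
Variables (R : idomainType) (p : nat) (m : set R) (hR : pro_p_ring p m).
Variables (d : nat) (G : topologicalGroupType) (A : set (chart m G d)).
Variables (N : nat) (S : set G) (phi : G -> adic m d).
Hypothesis hA : full_atlas c A.
Hypothesis hS : open_standard_subgroup c A N S phi.
Local Notation "m^ n" := (ideal_pow m n) (at level 2, n at level 1, format "m^ n").
Local Notation Gn := (natural_filtration N S phi).

Lemma std_subgroup : is_subgroup S. Proof. by case: hS => _ []. Qed.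

Lemma std_open : open S. Proof. by case: hS => _ []. Qed.

Lemma std_atlas : A (S, phi). Proof. by case: hS. Qed.

Lemma std_phi1 : phi 1%g = 0. Proof. by case: hS => _ _ _ []. Qed.

Lemma std_image : phi @` S = ideal_powV m N. Proof. by case: hS => _ _ _ []. Qed.

Lemma std_phi_in x : S x -> ideal_powV m N (phi x).
Proof. by move=> Sx; rewrite -std_image; exists x. Qed.

(* Only the mixed monomials of [F(X, Y)] contribute to
   [F(u, v) - F(u, 0) - F(0, v)], and they lie in m^(i+j). *)
Lemma std_mul_approx x y i j : S x -> S y -> ideal_powV m i (phi x) ->
  ideal_powV m j (phi y) ->
  ideal_powV m (i + j) (phi (x * y)%g - phi x - phi y).
Proof.
have [S1 SM _] := std_subgroup.
move=> Sx Sy xi yj k; have [_ _ _ _ [F [F0 HF]]] := hS.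
have sxy := HF _ _ Sx Sy k.
have := HF _ _ Sx S1 k; rewrite mulg1 std_phi1 => sx.
have := HF _ _ S1 Sy k; rewrite mul1g std_phi1 => sy.
rewrite mxE [X in _ + X]mxE [X in X + _]mxE [X in _ + X + _]mxE.
apply: (sums_to_abs_le_pow c_gt1 hR (n := i + j)); last first.
  rewrite !tofracB; exact: (sums_toB c_gt1 hR (sums_toB c_gt1 hR sxy sx) sy).
move=> al /=; pose P (w : 'rV[R]_(d + d)) := \prod_l w ord0 l ^+ al l.
have toE (w : 'rV[R]_(d + d)) :
    \prod_l tofrac (w ord0 l) ^+ al l = tofrac (P w).
  by rewrite rmorph_prod; apply: eq_bigr => l _; rewrite rmorphXn.
rewrite !toE -!tofracM -!tofracB -!mulrBr (fraction_abs_tofrac c_gt1 hR).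
apply/(adic_abs_le c_gt1 hR).
pose al1 l := al (lshift d l); pose al2 l := al (rshift d l).
have PE (u v : 'rV[R]_d) : P (row_mx u v) =
    (\prod_l u ord0 l ^+ al1 l) * (\prod_l v ord0 l ^+ al2 l).
  rewrite /P big_split_ord; congr (_ * _); apply: eq_bigr => l _.
    by rewrite row_mxEl.
  by rewrite row_mxEr.
have I0 : m^(i + j) 0 by exact: (ideal0 (is_ideal_pow m (i + j))).
rewrite !PE; have z0 (f : 'I_d -> nat) :
    \prod_l (0 : 'rV[R]_d) ord0 l ^+ f l = \prod_l (0 : R) ^+ f l.
  by apply: eq_bigr => l _; rewrite mxE.
have cases (f : 'I_d -> nat) : (exists l, (0 < f l)%N) \/ forall l, f l = 0%N.
  have [[l fl]|no] := pselect (exists l, (0 < f l)%N); first by left; exists l.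
  by right=> l; apply/eqP; rewrite -leqn0 leqNgt; apply/negP => fl; apply: no; exists l.
rewrite !z0; have [[l1 a1]|a1] := cases al1; have [[l2 a2]|a2] := cases al2.
- rewrite !(prod0_pow _ a1) !(prod0_pow _ a2) mulr0 mul0r !subr0.
  apply: (idealMl (is_ideal_pow m (i + j))).
  by apply: ideal_powD; [exact: ideal_pow_monomial xi a1|exact: ideal_pow_monomial yj a2].
- by rewrite !(prod0_pow _ a1) !(prod_pow0 _ a2) mul0r subrr subr0 mulr0.
- by rewrite !(prod0_pow _ a2) !(prod_pow0 _ a1) mulr0 subr0 subrr mulr0.
- have -> : al = [ffun=> 0%N].
    apply/ffunP => l; rewrite ffunE; case: (split_ordP l) => l' ->.
      exact: a1.
    exact: a2.
  by rewrite F0 mul0r.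
Qed.

(** For [y = z * x], [phi y - phi x] differs from [phi z] by an error deeper than [phi z] itself.
    Cosets of the filtration thus become classes modulo powers of [m] in the chart. *)
Lemma std_coset n x y : S x -> S y ->
  Gn n (y * x^-1)%g <-> ideal_powV m (N + n) (phi y - phi x).
Proof.
have [S1 SM SV] := std_subgroup; have N0 : (0 < N)%N by case: hS.
move=> Sx Sy; pose z := (y * x^-1)%g.
have Sz : S z by apply: SM => //; exact: SV.
have yE : phi y - phi z - phi x = phi (z * x)%g - phi z - phi x.
  by rewrite /z mulgVK.
split=> [[_ /= zn]|yx].
  have := std_mul_approx Sz Sx zn (std_phi_in Sx); rewrite -yE.
  move=> /(ideal_powV_le (leq_addr N (N + n))) h.
  by have := ideal_powVD h zn; rewrite addrAC subrK.
(* Bootstrapping: [phi z] in [m^(N+k)] makes the error lie in [m^(N+k+N)], and [N >= 1] gains at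
   least one power. *)
suff zk k : (k <= n)%N -> ideal_powV m (N + k) (phi z) by split=> //; exact: zk.
elim: k => [_|k IHk kn]; first by rewrite addn0; exact: std_phi_in.
have := std_mul_approx Sz Sx (IHk (ltnW kn)) (std_phi_in Sx); rewrite -yE.
have le1 : (N + k.+1 <= N + k + N)%N by lia.
have le2 : (N + k.+1 <= N + n)%N by lia.
move=> /(ideal_powV_le le1) h; have := ideal_powVB (ideal_powV_le le2 yx) h.
by have -> : phi y - phi x - (phi y - phi z - phi x) = phi z
  by rewrite opprB addrA subrK opprB addrC subrK.
Qed.

Lemma natural_filtration_subgroup n : is_subgroup (Gn n).
Proof.
have [S1 SM SV] := std_subgroup.
have H1 : Gn n 1%g by split=> //=; rewrite std_phi1; exact: ideal_powV0.
have HB x y : Gn n x -> Gn n y -> Gn n (x * y^-1)%g.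
  by move=> [Sx xn] [Sy yn]; apply/std_coset => //; exact: ideal_powVB.
have HV x : Gn n x -> Gn n x^-1%g by move=> Gx; have := HB _ _ H1 Gx; rewrite mul1g.
by split=> // x y Gx Gy; have := HB _ _ Gx (HV _ Gy); rewrite invgK.
Qed.

Lemma natural_filtration_le k n : (k <= n)%N -> Gn n `<=` Gn k.
Proof.
move=> kn x [Sx xn]; split=> //; apply: ideal_powV_le xn.
by rewrite leq_add2l.
Qed.

Lemma open_adic_ball n (y : adic m d) : open [set x : adic m d | ideal_powV m n (x - y)].
Proof.
move=> z zy; exists n => x /= xz.
by have := ideal_powVD xz zy; rewrite addrA subrK.
Qed.

Lemma open_chart_preimage (C : chart m G d) n (y : adic m d) : A C ->
  open (C.1 `&` C.2 @^-1` [set x | ideal_powV m n (x - y)]).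
Proof.
move=> /(atlas_chart hA)[oC _ _ cC _]; rewrite openE => x [Cx xy].
apply: filterI; first by apply: open_nbhs_nbhs.
move: cC; rewrite continuous_open_subspace // => /(_ x (mem_set Cx)); apply.
by apply: open_nbhs_nbhs; split => //; exact: open_adic_ball.
Qed.

Lemma natural_filtration_open n : open (Gn n).
Proof.
have := open_chart_preimage (N + n) 0 std_atlas; congr open.
by apply/seteqP; split=> x [Sx xn]; split=> //; move: xn; rewrite /= subr0.
Qed.

End StandardGroup.

(** * Integral bases of subspaces of K^d *)

Section IntegralBases.
Variable R : idomainType.
Local Notation K := {fraction R}.
Local Notation toK := (map_mx (@tofrac R)).

Lemma toK_inj r s : injective (toK : 'M[R]_(r, s) -> 'M[K]_(r, s)).
Proof.
move=> X Y XY; apply/matrixP => i j; apply/eqP; rewrite -tofrac_eq; apply/eqP.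
by have := congr1 (fun Z : 'M[K]_(r, s) => Z i j) XY; rewrite !mxE.
Qed.

Lemma common_denominator r s (X : 'M[K]_(r, s)) :
  exists (b : R) (Y : 'M[R]_(r, s)), b != 0 /\ toK Y = tofrac b *: X.
Proof.
pose num (z : K) : R := (frac (repr z)).1; pose den (z : K) : R := (frac (repr z)).2.
have den0 (z : K) : den z != 0 by exact: denom_ratioP.
exists (\prod_(ij : 'I_r * 'I_s) den (X ij.1 ij.2)).
exists (\matrix_(i, j) (num (X i j) *
  \prod_(kl : 'I_r * 'I_s | kl != (i, j)) den (X kl.1 kl.2))); split.
  by rewrite prodf_seq_neq0; apply/seq.allP => ij _ /=.
apply/matrixP => i j; rewrite !mxE [in RHS](bigD1 (i, j)) //= !tofracM.
rewrite [X in _ = _ * X]fraction_repr -/(num _) -/(den _).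
by rewrite [RHS]mulrC mulrA divfK ?tofrac_eq0.
Qed.

(** The rows of [M] are a basis of [E] and [P] is a right inverse of the basis matrix, both cleared
    of denominators; [b] is the product of the two denominators. The last clause turns membership in
    [E] into linear equations over [R]. *)
Lemma integral_basis d e (E : {vspace 'rV[K]_d}) : \dim E = e ->
  exists (b : R) (M : 'M[R]_(e, d)) (P : 'M[R]_(d, e)),
  [/\ b != 0, forall w, toK (w *m M) \in E, M *m P = b%:M
    & forall v, toK v \in E <-> v *m P *m M = b *: v].
Proof.
move=> <-; pose M0 := \matrix_(i < \dim E) (vbasis E)`_i.
have M0E w : w *m M0 \in E.
  rewrite mulmx_sum_row; apply: memv_suml => i _; apply: memvZ.
  by rewrite rowK; apply: vbasis_mem; apply: mem_nth; rewrite size_tuple.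
have EM0 v : v \in E -> exists w, v = w *m M0.
  move=> vE; exists (\row_i coord (vbasis E) i v).
  rewrite mulmx_sum_row [LHS](coord_vbasis vE); apply: eq_bigr => i _.
  by rewrite mxE rowK.
have [P0 MP0] : exists P0, M0 *m P0 = 1%:M.
  apply/row_freeP/inj_row_free => w w0; apply/rowP => i; rewrite mxE.
  have /freeP := basis_free (vbasisP E); apply; rewrite -[RHS]w0 mulmx_sum_row.
  by apply: eq_bigr => j _; rewrite rowK.
have [b1 [M [b10 ME]]] := common_denominator M0.
have [b2 [P [b20 PE]]] := common_denominator P0.
have b0 : b1 * b2 != 0 by rewrite mulf_neq0.
exists (b1 * b2), M, P; split=> //.
- by move=> w; rewrite map_mxM /= ME -scalemxAr memvZ.
- apply: toK_inj; rewrite map_mxM /= ME PE -scalemxAl -scalemxAr MP0 map_scalar_mx.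
  by rewrite scalerA -tofracM scale_scalar_mx mulr1.
move=> v; split=> [/EM0[w vw]|vPM].
  apply: toK_inj; rewrite !map_mxM /= ME PE vw map_mxZ /= vw tofracM.
  by rewrite -!scalemxAr -scalemxAl -!mulmxA [M0 *m (P0 *m _)]mulmxA MP0 mul1mx scalerA.
have : toK (b1 * b2 *: v) \in E by rewrite -vPM map_mxM /= ME -scalemxAr memvZ.
rewrite map_mxZ /= => /(memvZ (tofrac (b1 * b2))^-1).
by rewrite scalerA mulVf ?scale1r // tofrac_eq0.
Qed.

End IntegralBases.

(** * Counting the cosets that meet an analytic subgroup *)

Section CosetCounts.
Variables (RR : realType) (c : RR) (c_gt1 : 1 < c).
Variables (R : idomainType) (p : nat) (m : set R) (hR : pro_p_ring p m).
Variables (pi : R) (pi_neq0 : pi != 0) (m_pi : m pi).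
Variables (d : nat) (G : topologicalGroupType) (A : set (chart m G d)).
Hypothesis hG : analytic_group c A.
Hypothesis cG : compact [set: G].
Variables (N : nat) (S : set G) (phi : G -> adic m d).
Hypothesis hS : open_standard_subgroup c A N S phi.
Local Notation "m^ n" := (ideal_pow m n) (at level 2, n at level 1, format "m^ n").
Local Notation Gn := (natural_filtration N S phi).
Local Notation ord := (adic_ord m).

Let hA : full_atlas c A := analytic_group_atlas hG.

(** Multiplication is analytic in product charts; keeping the second factor equal to [z0] makes the
    second block of the difference vanish. Right translations are the ones that permute the right
    cosets. *)
Lemma translation_lipschitz (C D : chart m G d) (x0 z0 : G) : A C -> A D ->
  C.1 x0 -> D.1 (x0 * z0)%g -> exists l k, forall x x', C.1 x -> C.1 x' ->
    ideal_powV m l (C.2 x - C.2 x0) -> ideal_powV m l (C.2 x' - C.2 x0) ->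
    [/\ D.1 (x * z0)%g, D.1 (x' * z0)%g & forall n,
      ideal_powV m (n + k) (C.2 x - C.2 x') ->
      ideal_powV m n (D.2 (x * z0)%g - D.2 (x' * z0)%g)].
Proof.
move=> AC AD Cx0 Dxz; have [B AB Bz0] := atlas_cover hA z0.
have [_ /(_ (prod_chart C B) D)] := analytic_group_mul hG.
case=> //; first by exists C => //; exists B.
set W := _ `&` _ => g ang gE.
have W0 : W (x0, z0) by [].
have [|l [k lip]] := analytic_lipschitz c_gt1 hR pi_neq0 m_pi ang
  (y := (prod_chart C B).2 (x0, z0)).
  by exists (x0, z0).
have diffE x x' : (prod_chart C B).2 (x, z0) - (prod_chart C B).2 (x', z0) =
    row_mx (C.2 x - C.2 x' : 'rV_d) (0 : 'rV_d).
  by rewrite /= opp_row_mx add_row_mx subrr.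
have near n x x' : ideal_powV m n (C.2 x - C.2 x') ->
    ideal_powV m n ((prod_chart C B).2 (x, z0) - (prod_chart C B).2 (x', z0)).
  rewrite diffE => h i; case: (split_ordP i) => j ->; rewrite ?row_mxEl ?row_mxEr //.
  exact: ideal_powV0.
(* The Lipschitz estimate only places the coordinates in the image of [W]; injectivity of both
   charts brings this back to the point itself. *)
have inW x : C.1 x -> ((prod_chart C B).2 @` W) ((prod_chart C B).2 (x, z0)) ->
    W (x, z0).
  move=> Cx [[y z] Wyz /= /eq_row_mx[yx zz]].
  have [[/= Cy Bz] Dyz] := Wyz.
  have [_ _ Ci _ _] := atlas_chart hA AC; have [_ _ Bi _ _] := atlas_chart hA AB.
  rewrite (Ci x y (mem_set Cx) (mem_set Cy) (esym yx)).
  by rewrite (Bi z0 z (mem_set Bz0) (mem_set Bz) (esym zz)).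
exists l, k => x x' Cx Cx' xl x'l.
have [Vx Vx' xx'] := lip _ _ (near _ _ _ xl) (near _ _ _ x'l).
have Wx := inW _ Cx Vx; have Wx' := inW _ Cx' Vx'.
split; [by case: Wx|by case: Wx'|move=> n /near /xx'].
by rewrite !gE.
Qed.

Variables (H : set G) (sgH : is_subgroup H).
Variables (x0 : G) (C : chart m G d) (E : {vspace 'rV[{fraction R}]_d}) (e : nat).
Hypotheses (Hx0 : H x0) (adC : adapted_chart A H x0 C E) (dimE : \dim E = e).

Let AC : A C. Proof. by case: adC. Qed.
Let Cx0 : C.1 x0. Proof. by case: adC. Qed.
Let C0 : C.2 x0 = 0. Proof. by case: adC. Qed.
Let chC : is_chart C := atlas_chart hA AC.
Let sgS : is_subgroup S := std_subgroup hS.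

Lemma adapted_mem x : C.1 x -> H x <-> map_mx (@tofrac R) (C.2 x) \in E.
Proof.
have [_ _ inj _ _] := chC; have [_ _ _ im] := adC.
move=> Cx; split=> [Hx|xE].
  have : (C.2 @` (H `&` C.1)) (C.2 x) by exists x.
  by rewrite im => -[].
have : (C.2 @` (H `&` C.1)) (C.2 x) by rewrite im; split=> //; exists x.
by move=> [y [Hy Cy] yx]; rewrite -(inj y x) ?inE.
Qed.

(** Together with [backward_lipschitz]: right translation by [x0] is locally bi-Lipschitz from the
    standard chart at 1, where cosets are visible, to the chart at [x0], where [H] is linear. *)
Lemma forward_lipschitz : exists l k, forall y y',
  S y -> S y' -> ideal_powV m l (phi y) -> ideal_powV m l (phi y') ->
  [/\ C.1 (y * x0)%g, C.1 (y' * x0)%g & forall n,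
    ideal_powV m (n + k) (phi y - phi y') ->
    ideal_powV m n (C.2 (y * x0)%g - C.2 (y' * x0)%g)].
Proof.
have [S1 _ _] := sgS.
have [||l [k lip]] := @translation_lipschitz (S, phi) C 1%g x0 (std_atlas hS) AC.
- exact: S1.
- by rewrite mul1g.
exists l, k => y y' Sy Sy' yl yl'.
by apply: lip => //=; rewrite (std_phi1 hS) subr0.
Qed.

Lemma backward_lipschitz : exists l k, forall z z',
  C.1 z -> C.1 z' -> ideal_powV m l (C.2 z) -> ideal_powV m l (C.2 z') ->
  [/\ S (z * x0^-1)%g, S (z' * x0^-1)%g & forall n,
    ideal_powV m (n + k) (C.2 z - C.2 z') ->
    ideal_powV m n (phi (z * x0^-1)%g - phi (z' * x0^-1)%g)].
Proof.
have [S1 _ _] := sgS.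
have [||l [k lip]] := @translation_lipschitz C (S, phi) x0 (x0^-1)%g AC (std_atlas hS).
- exact: Cx0.
- by rewrite mulgV.
exists l, k => y y' Sy Sy' yl yl'.
by apply: lip => //=; rewrite C0 subr0.
Qed.

Let fin_cosets n (X : set G) : finite_set (right_coset (Gn n) @` X).
Proof.
apply: (@sub_finite_set _ _ (range (right_coset (Gn n)))).
  by move=> _ [x _ <-]; exists x.
apply: finite_right_cosets => //.
- exact: (natural_filtration_open hA hS).
- exact: (natural_filtration_subgroup c_gt1 hR hS).
Qed.

Definition coset_count (X : set G) n := nclasses (right_coset (Gn n)) X.

Let cosetP n x y : right_coset (Gn n) x = right_coset (Gn n) y <-> Gn n (x * y^-1)%g.
Proof. exact: (right_cosetP (natural_filtration_subgroup c_gt1 hR hS n)). Qed.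

Hypothesis fin_Q : forall n, finite_set (range (residue m n)).

Lemma ideal_pow_div a n x : a != 0 -> m^(n + ord a) (a * x) -> m^n x.
Proof.
move=> a0; have [->|x0'] := eqVneq x 0.
  by move=> _; exact: (ideal0 (is_ideal_pow m n)).
move=> /(leq_adic_ord hR _ (mulf_neq0 a0 x0')).
by rewrite (adic_ordM hR) // addnC leq_add2l => /(leq_adic_ord hR _ x0').
Qed.

(** The points of [H] with coordinates [t *: (w *m M)], translated back by [x0^-1], are separated by
    cosets: from equal cosets, the forward estimate and multiplication by [P] give
    [t * b * (w - w')] in a deep power of [m], hence [w = w'] modulo [m^i]. *)
Lemma coset_count_ge : exists K, forall i, (quot_card m i ^ e <= coset_count H (i + K))%N.
Proof.
have [b [M [P [b0 EM MP _]]]] := integral_basis dimE.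
have [l1 [k1 fwd]] := forward_lipschitz.
have [l2 [k2 bwd]] := backward_lipschitz.
have [S1 SM SV] := sgS; have [H1 HM HV] := sgH.
have [_ op _ _ _] := chC.
have [l3 ball] : exists l, [set x | ideal_powV m l x] `<=` C.2 @` C.1.
  have [|l hl] := op (C.2 x0); first by exists x0.
  by exists l => x xl; apply: hl; rewrite /= C0 subr0.
(* [l2] is the radius of the backward estimate, [l1 + k2] brings the translated point into the
   domain of the forward one, and [l3] is the radius of a ball inside the image of the chart. *)
pose L := (l2 + (l1 + k2) + l3)%N.
pose t := pi ^+ L; have t0 : t != 0 by rewrite expf_neq0.
have mt : m^L t.
  have := @ideal_powX _ m 1 L pi; rewrite muln1; apply.
  by apply/ideal_pow1 => //; exact: pro_p_ideal hR.
have near l (w : 'rV[R]_e) : (l <= L)%N -> ideal_powV m l (t *: (w *m M)).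
  move=> lL; apply: (ideal_powV_le lL); rewrite -[L]addn0.
  by apply: ideal_powVZ => //.
have l2L : (l2 <= L)%N by rewrite /L; lia.
have /choice[z zP] (w : 'rV[R]_e) : exists z, C.1 z /\ C.2 z = t *: (w *m M).
  have : (C.2 @` C.1) (t *: (w *m M)) by apply: ball; apply: near; rewrite /L; lia.
  by move=> [z Cz zw]; exists z.
have Hz w : H (z w).
  have [Cz zw] := zP w; apply/adapted_mem => //.
  by rewrite zw scalemxAl; exact: EM.
pose y w := (z w * x0^-1)%g.
have Hy w : H (y w) by apply: HM => //; exact: HV.
have zl l w : (l <= L)%N -> ideal_powV m l (C.2 (z w)).
  by move=> lL; have [_ ->] := zP w; exact: near.
have Sy w : S (y w).
  have [Cz _] := zP w.
  by have [] := bwd _ _ Cz Cz (zl l2 w l2L) (zl l2 w l2L).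
have yl w : ideal_powV m l1 (phi (y w)).
  have [Cz _] := zP w.
  have x0l : ideal_powV m l2 (C.2 x0) by rewrite C0; exact: ideal_powV0.
  have [_ _ /(_ l1)] := bwd _ _ Cz Cx0 (zl _ w l2L) x0l.
  rewrite mulgV (std_phi1 hS) C0 !subr0; apply; apply: zl; rewrite /L; lia.
exists (ord (t * b) + k1)%N => i.
have [g [_ gI _]] := nclasses_enum (fin_Q i).
pose J : finType := {ffun 'I_e -> 'I_(quot_card m i)}.
have <- : #|J| = (quot_card m i ^ e)%N by rewrite card_ffun !card_ord.
pose wf (f : J) : 'rV[R]_e := \row_k g (f k).
apply: (leq_nclasses (h := fun f : J => y (wf f))) => //.
move=> f f' /cosetP /(std_coset c_gt1 hR hS) => /(_ (Sy _) (Sy _)) ff'.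
apply/ffunP => k; apply: gI; apply/residueP.
apply: (@ideal_pow_div (t * b)); first by rewrite mulf_neq0.
have [_ _ /(_ (i + ord (t * b))%N)] := fwd _ _ (Sy (wf f)) (Sy (wf f')) (yl _) (yl _).
have zy w : (y w * x0)%g = z w by rewrite /y mulgVK.
rewrite !zy (zP _).2 (zP _).2 => h.
have {}h : ideal_powV m (i + ord (t * b)) (t *: (wf f *m M) - t *: (wf f' *m M)).
  by apply: h; apply: ideal_powV_le ff'; lia.
have := ideal_powV_mulmx P h k.
rewrite -scalerBr -mulmxBl -scalemxAl -mulmxA MP mul_mx_scalar scalerA.
by rewrite !mxE.
Qed.

(** [H] is cut into its finitely many classes modulo [Gn l], each brought near 1 by an element of
    [H]. There the [e] coordinates [w], taken modulo [m^j], determine the coset. *)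
Lemma coset_count_le : exists K B, forall n,
  (coset_count H n <= B * quot_card m (n + K) ^ e)%N.
Proof.
have [b [M [P [b0 EM MP EP]]]] := integral_basis dimE.
have [l1 [k1 fwd]] := forward_lipschitz.
have [l2 [k2 bwd]] := backward_lipschitz.
have [S1 SM SV] := sgS; have [H1 HM HV] := sgH.
(* [l1] allows the forward estimate; [l2 + k1] makes the translated point land where the backward
   one holds. *)
pose l := (l1 + (l2 + k1))%N.
have Gl y : Gn l y -> S y /\ ideal_powV m l (phi y).
  by move=> [Sy yl]; split=> //; apply: ideal_powV_le yl; exact: leq_addl.
have phi1 : ideal_powV m l1 (phi 1%g).
  by rewrite (std_phi1 hS); exact: ideal_powV0.
have Cl y : Gn l y -> C.1 (y * x0)%g /\ ideal_powV m l2 (C.2 (y * x0)%g).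
  move=> /Gl[Sy yl]; have yl1 := ideal_powV_le (leq_addr _ _ : l1 <= l)%N yl.
  have [Cy _ /(_ l2)] := fwd _ _ Sy S1 yl1 phi1.
  rewrite mul1g C0 (std_phi1 hS) !subr0 => h; split=> //; apply: h.
  by apply: ideal_powV_le yl; exact: leq_addl.
pose w y : 'rV[R]_e := C.2 (y * x0)%g *m P.
(* [N] is the level of the chart, [k2] the backward loss, and [ord b] the cost of dividing by
   [b]. *)
exists (N + k2 + ord b)%N, (coset_count H l) => n.
set j := (n + _)%N.
have close y y' : H y -> H y' -> Gn l y -> Gn l y' -> ideal_powV m j (w y - w y') ->
    Gn n (y * y'^-1)%g.
  move=> Hy Hy' Gy Gy' ww'.
  have [Cy yl2] := Cl _ Gy; have [Cy' yl2'] := Cl _ Gy'.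
  have [_ _ /(_ (N + n)%N)] := bwd _ _ Cy Cy' yl2 yl2'.
  rewrite !mulgK => h; apply/(std_coset c_gt1 hR hS); [by case: Gy'|by case: Gy|].
  apply: h => i; apply: (@ideal_pow_div b) => //.
  have v y1 : H y1 -> C.1 (y1 * x0)%g -> w y1 *m M = b *: C.2 (y1 * x0)%g.
    by move=> Hy1 Cy1; apply/EP/adapted_mem => //; exact: HM.
  have := ideal_powV_mulmx M ww' i.
  rewrite mulmxBl !v // -scalerBr mxE; apply: ideal_pow_le; rewrite /j; lia.
have [g [Hg _ gS]] := nclasses_enum (fin_cosets l H).
have [r [_ rI rS]] := nclasses_enum (fin_Q j).
have /choice[u uP] y : exists u, H y -> Gn l (y * (g u)^-1)%g.
  have [Hy|nHy] := pselect (H y); last by have [u _] := gS 1%g H1; exists u.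
  by have [u /cosetP yu] := gS y Hy; exists u.
have /choice[rho rhoP] a : exists q, residue m j a = residue m j (r q) by exact: rS.
pose J : finType := ('I_(coset_count H l) * {ffun 'I_e -> 'I_(quot_card m j)})%type.
have <- : #|J| = (coset_count H l * quot_card m j ^ e)%N.
  by rewrite card_prod card_ffun !card_ord.
pose h y : J := (u y, [ffun k => rho (w (y * (g (u y))^-1)%g ord0 k)]).
apply: (nclasses_leq (h := h)) => // y y' Hy Hy' [uu' /ffunP ww'].
have Hgu z v : H z -> H (z * (g v)^-1)%g by move=> Hz; apply: HM => //; exact: HV.
apply/cosetP.
have -> : (y * y'^-1 = (y * (g (u y))^-1) * (y' * (g (u y'))^-1)^-1)%g.
  by rewrite uu' invgM invgK mulgA mulgVK.
apply: close; [exact: Hgu|exact: Hgu|exact: uP|exact: uP|].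
move=> k; have := ww' k; rewrite !ffunE !mxE => e1.
by apply/residueP; rewrite rhoP e1 -rhoP.
Qed.

(** Near [x0], [H] is the zero set of the linear map [Z]. At a limit point the value of [Z] lies in
    every [m^n], so it is 0 by separatedness. *)
Lemma analytic_subgroup_closed : closed H.
Proof.
have [b [M [P [b0 EM MP EP]]]] := integral_basis dimE.
have [l1 [k1 fwd]] := forward_lipschitz.
have [S1 SM SV] := sgS; have [H1 HM HV] := sgH.
apply: (closed_subgroup (K := Gn l1)) => //.
- exact: (natural_filtration_subgroup c_gt1 hR hS).
- exact: (natural_filtration_open hA hS).
move=> y [cly [Sy yl]].
have yl1 : ideal_powV m l1 (phi y) by apply: ideal_powV_le yl; exact: leq_addl.
have [Cy _ _] := fwd _ _ Sy Sy yl1 yl1.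
rewrite -[y](mulgK x0); apply: (HM); last exact: HV.
apply/adapted_mem => //; apply/EP; apply/eqP; rewrite -subr_eq0; apply/eqP.
apply/rowP => i; rewrite [RHS]mxE; apply: (pro_p_separated hR) => n.
pose Z (v : 'rV[R]_d) := v *m P *m M - b *: v.
have ZB u v : Z u - Z v = (u - v) *m P *m M - b *: (u - v).
  by rewrite /Z !mulmxBl scalerBr !opprD !opprK addrACA.
have := open_chart_preimage hA n (C.2 (y * x0)%g) AC.
set V := _ `&` _ => oV.
have : nbhs y ((fun y => (y * x0)%g) @^-1` V).
  apply: mulgr_continuous; apply: open_nbhs_nbhs; split=> //; split=> //=.
  by rewrite subrr; exact: ideal_powV0.
move=> /cly[h [Hh [Ch /= hy]]].
have Zh : Z (C.2 (h * x0)%g) = 0.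
  apply/eqP; rewrite subr_eq0; apply/eqP/EP/adapted_mem => //; exact: HM.
have -> : C.2 (y * x0)%g *m P *m M - b *: C.2 (y * x0)%g =
    - (Z (C.2 (h * x0)%g) - Z (C.2 (y * x0)%g)).
  by rewrite Zh sub0r opprK.
rewrite ZB; apply: ideal_powVN; apply: ideal_powVB.
  by apply: ideal_powV_mulmx; exact: ideal_powV_mulmx.
by have := @ideal_powVZ _ m d 0 n _ b I hy.
Qed.

End CosetCounts.

(** * Hausdorff measures with respect to a filtration *)

Section FiltrationHausdorffMeasure.
Variables (RR : realType) (G : topologicalGroupType) (Gn : nat -> set G).
Hypothesis cG : compact [set: G].
Hypothesis sgGn : forall n, is_subgroup (Gn n).
Hypothesis oGn : forall n, open (Gn n).
Hypothesis leGn : forall k n, (k <= n)%N -> Gn n `<=` Gn k.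
Local Notation dist := (filtration_dist RR Gn).
Local Notation coset n := (right_coset (Gn n)).
Let count X n := nclasses (coset n) X.
Let D n : RR := (subgroup_index (Gn n))%:R.

Let cosetP n x y : coset n x = coset n y <-> Gn n (x * y^-1)%g.
Proof. exact: right_cosetP. Qed.

Lemma finite_coset_image n (X : set G) : finite_set (coset n @` X).
Proof.
apply: (@sub_finite_set _ _ (range (coset n))); last exact: finite_right_cosets.
by move=> _ [x _ <-]; exists x.
Qed.

Lemma index_gt0 n : 0 < D n.
Proof.
rewrite ltr0n; apply: (@nclasses_gt0 _ _ (coset n) [set: G]).
  exact: finite_coset_image.
by exists 1%g.
Qed.

Lemma index_le k n : (k <= n)%N -> D k <= D n.
Proof.
move=> kn; rewrite ler_nat.
have [g [_ gI _]] := nclasses_enum (finite_coset_image k [set: G]).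
rewrite -[leqLHS]card_ord; apply: (@leq_nclasses _ _ (coset n) _ [set: G] g) => //.
  exact: finite_coset_image.
by move=> i j /cosetP /(leGn kn) /cosetP /gI.
Qed.

Lemma filtration_dist_ge0 x y : 0 <= dist x y.
Proof.
rewrite /filtration_dist; case: asboolP => // -[n xyn]; apply: lb_le_inf.
  by exists (D n)^-1, n.
by move=> _ [k _ <-]; rewrite invr_ge0 ltW // index_gt0.
Qed.

Lemma filtration_dist_le n x y : Gn n (x * y^-1)%g -> dist x y <= (D n)^-1.
Proof.
move=> xyn; rewrite /filtration_dist; case: asboolP => [_|[]]; last by exists n.
apply: ge_inf; last by exists n.
by exists 0 => _ [k _ <-]; rewrite invr_ge0 ltW // index_gt0.
Qed.

Lemma filtration_dist_ge n x y : ~ Gn n.+1 (x * y^-1)%g -> (D n)^-1 <= dist x y.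
Proof.
move=> xyn; rewrite /filtration_dist; case: asboolP => [[k xyk]|_].
  apply: lb_le_inf; first by exists (D k)^-1, k.
  move=> _ [l /= xyl <-]; rewrite lef_pV2 ?posrE ?index_gt0 //.
  apply: index_le; rewrite leqNgt; apply/negP => nl; apply: xyn.
  exact: leGn xyl.
by rewrite invf_le1 ?index_gt0 // ler1n -(ltr0n RR) index_gt0.
Qed.

Lemma filtration_dist_eq1 x y : ~ Gn 0%N (x * y^-1)%g -> dist x y = 1.
Proof.
move=> xy0; rewrite /filtration_dist; case: asboolP => // -[n xyn].
by case: xy0; exact: leGn xyn.
Qed.

Lemma diameter_ge U x y : U x -> U y -> ((dist x y)%:E <= diameter dist U)%E.
Proof. by move=> Ux Uy; apply: ereal_sup_ubound; exists x => //; exists y. Qed.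

Lemma diameter_pow_ge s U x y : 0 <= s -> U x -> U y ->
  ((dist x y `^ s)%:E <= diameter_pow dist s U)%E.
Proof.
move=> s0 Ux Uy; rewrite /diameter_pow; case: asboolP => [U0|_].
  by move: Ux; rewrite U0.
have xyU := diameter_ge Ux Uy.
rewrite -poweR_EFin; apply: gt0_ler_poweR => //; rewrite in_itv /= leey andbT.
  by rewrite lee_fin filtration_dist_ge0.
by apply: le_trans xyU; rewrite lee_fin filtration_dist_ge0.
Qed.

Lemma diameter_coset_le n x : (diameter dist (coset n x) <= ((D n)^-1)%:E)%E.
Proof.
apply: ge_ereal_sup => _ [y yx [z zx <-]]; rewrite lee_fin.
apply: filtration_dist_le; apply/cosetP.
have cosetE u : coset n x u -> coset n u = coset n x.
  by move=> /right_coset_mem/cosetP.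
by rewrite (cosetE y yx) (cosetE z zx).
Qed.

Lemma diameter_pow_coset_le s n x : 0 <= s ->
  (diameter_pow dist s (coset n x) <= (((D n)^-1) `^ s)%:E)%E.
Proof.
move=> s0; have xx : coset n x x.
  by apply/right_coset_mem; rewrite mulgV; case: (sgGn n).
rewrite /diameter_pow; case: asboolP => [_|_]; first by rewrite lee_fin powR_ge0.
rewrite -poweR_EFin; apply: gt0_ler_poweR; rewrite ?in_itv /= ?leey ?andbT //.
- by apply: le_trans (diameter_ge xx xx); rewrite lee_fin filtration_dist_ge0.
- by rewrite lee_fin invr_ge0 ltW // index_gt0.
- exact: diameter_coset_le.
Qed.

Lemma diameter_pow_ge0 s U : (0 <= diameter_pow dist s U)%E.
Proof. by rewrite /diameter_pow; case: asboolP => // _; exact: poweR_ge0. Qed.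

Variable H : set G.
Hypothesis sgH : is_subgroup H.

Lemma hausdorff_measure_eq0 s : 0 <= s ->
  (forall eps delta, 0 < eps -> 0 < delta -> exists n, (D n)^-1 <= delta /\
     (count H n)%:R * ((D n)^-1 `^ s) <= eps) ->
  hausdorff_measure dist s H = 0%E.
Proof.
move=> s0 small; apply/eqP; rewrite eq_le; apply/andP; split; last first.
  apply: le_trans (ereal_sup_ubound (x := hausdorff_premeasure dist s 1 H) _).
    apply: le_ereal_inf_tmp => _ [U _ <-]; apply: nneseries_ge0 => n _ _.
    exact: diameter_pow_ge0.
  by exists 1 => //=.
apply: ge_ereal_sup => _ [delta /= delta0 <-].
apply/lee_addgt0Pr => eps eps0; rewrite add0e.
have [n [Dn Pn]] := small _ _ eps0 delta0.
have [g [_ _ gS]] := nclasses_enum (finite_coset_image n H).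
(* Padding by the empty set is free, since [diameter_pow] gives it the value 0 for every
   exponent. *)
pose U i : set G := if insub i is Some j then coset n (g j) else set0.
set t := (D n)^-1 `^ s in Pn *.
have t0 : 0 <= t by exact: powR_ge0.
apply: (@le_trans _ _ (\sum_(0 <= i <oo) diameter_pow dist s (U i))%E).
  apply: ereal_inf_lbound; exists U => //; split.
    move=> x Hx; have [j xj] := gS _ Hx; exists (val j) => //.
    by rewrite /U valK; apply/right_coset_mem/cosetP.
  move=> i; rewrite /U; case: insubP => [j _ _|_].
    by apply: le_trans (diameter_coset_le _ _) _; rewrite lee_fin.
  by apply: ge_ereal_sup => _ [y []].
apply: lime_le; first by apply: is_cvg_nneseries => *; exact: diameter_pow_ge0.
apply: nearW => k; apply: (@le_trans _ _ (\sum_(0 <= i < k)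
    (if (i < count H n)%N then t else 0)%:E)%E).
  apply: lee_sum => i _; rewrite /U; case: insubP => [j ji _|/negPf->].
    by rewrite ji; exact: diameter_pow_coset_le.
  by rewrite /diameter_pow; case: asboolP.
rewrite sumEFin lee_fin; apply: le_trans Pn.
have -> : \sum_(0 <= i < k) (if (i < count H n)%N then t else 0) =
    (minn k (count H n))%:R * t.
  elim: k => [|k IHk]; first by rewrite big_nil min0n mul0r.
  rewrite big_nat_recr //= IHk; case: ltnP => kP.
    by rewrite (minn_idPl kP) -[k.+1]addn1 natrD mulrDl mul1r.
  by rewrite (minn_idPr (leqW kP)) addr0.
by rewrite ler_wpM2r // ler_nat geq_minr.
Qed.

(** The uniform mass on [H] gives a coset of level [l] that meets [H] the mass [1 / count H l], and
    the total mass is 1. As the cover is finite, all masses are computed by counting at one finest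
    level [n]. *)
Lemma coset_cover_sum (k : nat) (Q : pred nat) (n_ : nat -> nat) (x_ : nat -> G) :
  H `<=` \bigcup_(i in [set i | (i < k)%N /\ Q i]) coset (n_ i) (x_ i) ->
  1 <= \sum_(i < k | Q i) ((count H (n_ i))%:R^-1 : RR).
Proof.
move=> cov; have [H1 HM HV] := sgH.
pose n := (\max_(i < k) n_ i)%N.
have nn (i : 'I_k) : (n_ i <= n)%N by exact: leq_bigmax.
have H0 : H !=set0 by exists 1%g.
have cnt_gt0 l : (0 < count H l)%N.
  by apply: nclasses_gt0 => //; exact: finite_coset_image.
have [g [Hg gI _]] := nclasses_enum (finite_coset_image n H).
pose T (i : 'I_k) : {pred 'I_(count H n)} := [pred t | `[< coset (n_ i) (x_ i) (g t) >]].
have TP i : (#|T i| * count H (n_ i) <= count H n)%N.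
  have memT t : T i t -> coset (n_ i) (g t) = coset (n_ i) (x_ i).
    by move=> /asboolP/right_coset_mem/cosetP.
  have [t0 Tt0|T0] := pickP (T i); last first.
    by rewrite eq_card0 // => t; exact: T0.
  have [g' [Hg' gI' _]] := nclasses_enum (finite_coset_image (n_ i) H).
  pose J : finType := ({t | T i t} * 'I_(count H (n_ i)))%type.
  have <- : #|J| = (#|T i| * count H (n_ i))%N by rewrite card_prod card_sig card_ord.
  (* Homogeneity: translations by elements of [H] copy the level [n] classes inside one coset into
     every coset of level [n_ i] meeting [H], so none contains more than its share. *)
  pose F (j : J) : G := (g (val j.1) * (g t0)^-1 * g' j.2)%g.
  have Fcoset j : coset (n_ i) (F j) = coset (n_ i) (g' j.2).
    by apply/cosetP; rewrite /F mulgK; apply/cosetP; rewrite !memT //; exact: valP.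
  apply: (leq_nclasses (h := F)); first exact: finite_coset_image.
    by move=> j; apply: (HM) => //; apply: HM => //; exact: HV.
  move=> [t u] [t' u'] e; have uu' : u = u'.
    by apply: gI'; have := Fcoset (t, u); have := Fcoset (t', u') => /= <- <-;
      apply/cosetP/(leGn (nn i))/cosetP.
  congr (_, _) => //; apply/val_inj/gI; move: e; rewrite /F /= uu'.
  by do 2 move=> /(right_coset_mulr (sgGn n)).
have sumT : (count H n <= \sum_(i < k | Q i) #|T i|)%N.
  rewrite -[leqLHS]card_ord -sum1_card.
  under [leqRHS]eq_bigr do rewrite -sum1_card big_mkcond /=.
  rewrite exchange_big /=; apply: leq_sum => t _.
  have [i [/= ik Qi] git] := cov _ (Hg t).
  rewrite (bigD1 (Ordinal ik)) //=.
  have -> : t \in T (Ordinal ik) by apply/asboolP.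
  by rewrite leq_addr.
have cntR l : 0 < (count H l)%:R :> RR by rewrite ltr0n.
rewrite -(ler_pM2l (cntR n)) mulr1 big_distrr /=.
apply: le_trans (_ : (\sum_(i < k | Q i) #|T i|)%:R <= _); first by rewrite ler_nat.
rewrite natr_sum; apply: ler_sum => i _.
by rewrite ler_pdivlMr // -natrM ler_nat.
Qed.

Hypothesis clH : closed H.

Lemma compact_sequence_cover (V : nat -> set G) : (forall i, open (V i)) ->
  H `<=` \bigcup_i V i -> exists k, H `<=` \bigcup_(i in [set i | (i < k)%N]) V i.
Proof.
move=> oV cov; have cH : compact H by exact: (subclosed_compact clH cG).
have := (compact_near_coveringP H).1 cH nat \oo
  (fun k x => (\bigcup_(i in [set i | (i < k)%N]) V i) x) _.
case.
  move=> x /cov[i _ Vix].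
  exists (V i, [set k | (i < k)%N]) => /=.
    by split; [apply: open_nbhs_nbhs|exists i.+1].
  by move=> [y k] /= [Vy ik]; exists i.
by move=> k _ /(_ k (leqnn k)) h; exists k.
Qed.

(** For the last [n] with [U] inside [coset n x], some point of [U] is at distance at least
    [(D n)^-1] from [x]. If there is no last [n], the diameter may be 0, and [tau] pays for a small
    coset. The bound by 1 forces [U] into [coset 0 x], as points outside are at distance 1. *)
Lemma cover_piece s (U : set G) x tau : 0 < s -> 0 < tau ->
  (forall y, exists n, y <= D n) -> U x -> (diameter_pow dist s U < 1)%E ->
  exists n, U `<=` coset n x /\
    (((D n)^-1 `^ s)%:E <= diameter_pow dist s U + tau%:E)%E.
Proof.
move=> s0 tau0 unb Ux dU1; have s0' := ltW s0.
have U0 : U `<=` coset 0%N x.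
  move=> y Uy; apply/right_coset_mem; apply: contrapT => n0.
  have yx1 := filtration_dist_eq1 n0.
  have := diameter_pow_ge s0' Uy Ux.
  by rewrite yx1 powR1 => /(lt_le_trans dU1); rewrite ltxx.
have [all_n|] := pselect (forall n, U `<=` coset n x).
  (* The threshold is the solution of [D n ^ (-s) = tau]. *)
  have [n hn] := unb (tau^-1 `^ s^-1); exists n; split=> //.
  apply: le_trans (_ : tau%:E <= _)%E; last first.
    by rewrite leeDr // diameter_pow_ge0.
  have D0 := ltW (index_gt0 n).
  have -> : (D n)^-1 `^ s = (D n `^ s)^-1.
    by rewrite -powR_inv1 // -powRrM mulN1r powRN.
  rewrite lee_fin -[tau]invrK lef_pV2 ?posrE ?invr_gt0 ?powR_gt0 ?index_gt0 //.
  have -> : tau^-1 = (tau^-1 `^ s^-1) `^ s.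
    by rewrite -powRrM mulVf ?gt_eqF // powRr1 // invr_ge0 ltW.
  by apply: ge0_ler_powR; rewrite ?nnegrE ?powR_ge0.
move=> /existsNP notall.
have ex : exists n, `[< ~ (U `<=` coset n x) >].
  by have [n hn] := notall; exists n; apply/asboolP.
case: (ex_minnP ex) => -[|n] /asboolP nU minU; first by case: nU.
have Un : U `<=` coset n x.
  apply: contrapT => nUn; have : (n.+1 <= n)%N by apply: minU; apply/asboolP.
  by rewrite ltnn.
exists n; split=> //.
have /existsNP[y /not_implyP[Uy nyx]] := nU.
have yx : (D n)^-1 <= dist y x.
  by apply: filtration_dist_ge => h; apply: nyx; apply/right_coset_mem.
apply: le_trans (_ : diameter_pow dist s U <= _)%E; last by rewrite leeDl // lee_fin ltW.
apply: le_trans (diameter_pow_ge s0' Uy Ux); rewrite lee_fin.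
by apply: ge0_ler_powR; rewrite ?nnegrE ?filtration_dist_ge0 // invr_ge0 ltW // index_gt0.
Qed.

(** Every nonempty piece contributes at least 1, since [0] to the power [0] is 1. *)
Lemma hausdorff_measure0_neq0 : hausdorff_measure dist 0 H <> 0%E.
Proof.
move=> hm0; have [H1 _ _] := sgH.
have : (hausdorff_premeasure dist 0 1 H < 1)%E.
  apply: (@le_lt_trans _ _ 0%E); last by rewrite lte_fin.
  by rewrite -hm0; apply: ereal_sup_ubound; exists 1 => //=.
move=> /ereal_inf_lt[_ [U [/(_ _ H1)[i _ Ui] _] <-]]; apply/negP; rewrite -leNgt.
apply: (le_trans _ (nneseries_lim_ge i.+1 _)) => [|j _ _]; last first.
  exact: diameter_pow_ge0.
have := diameter_pow_ge (lexx 0) Ui Ui; rewrite powRr0 => Ui1.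
rewrite big_nat_recr //=; apply: (le_trans Ui1); rewrite leeDr //.
by apply: sume_ge0 => j _; exact: diameter_pow_ge0.
Qed.

(** The mass distribution principle: a cover of small cost, enlarged to open cosets and made finite
    by compactness, would carry less than the total mass 1. *)
Lemma hausdorff_measure_neq0 s B : 0 < s -> 0 < B ->
  (forall y, exists n, y <= D n) ->
  (forall n, (count H n)%:R^-1 <= B * ((D n)^-1 `^ s)) ->
  hausdorff_measure dist s H <> 0%E.
Proof.
move=> s0 B0 unb mass hm0; have [H1 _ _] := sgH.
(* [kap <= 1] meets the size condition of [cover_piece]. The cover and its enlargement cost at most
   [kap] each, and [4 * B] keeps the resulting mass [B * (kap + kap)] below 1. *)
pose kap := Num.min 1 (4 * B)^-1.
have kap0 : 0 < kap by rewrite lt_min ltr01 invr_gt0 mulr_gt0.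
have kap1 : kap <= 1 by rewrite ge_min lexx.
have kapB : B * (kap + kap) < 1.
  have : kap <= (4 * B)^-1 by rewrite ge_min lexx orbT.
  rewrite -(ler_pM2l B0) invfM mulrCA mulfV ?gt_eqF // mulrDr; lra.
have : (hausdorff_premeasure dist s 1 H < kap%:E)%E.
  apply: (@le_lt_trans _ _ 0%E); last by rewrite lte_fin.
  by rewrite -hm0; apply: ereal_sup_ubound; exists 1 => //=.
move=> /ereal_inf_lt[_ [U [cov _] <-] sumU].
have partial k : (\sum_(0 <= i < k) diameter_pow dist s (U i) < kap%:E)%E.
  apply: le_lt_trans sumU; apply: nneseries_lim_ge => i _ _.
  exact: diameter_pow_ge0.
have Ui1 i : (diameter_pow dist s (U i) < 1)%E.
  apply: (@lt_le_trans _ _ kap%:E); last by rewrite lee_fin.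
  apply: le_lt_trans (partial i.+1); rewrite big_nat_recr //= leeDr //.
  by apply: sume_ge0 => j _; exact: diameter_pow_ge0.
pose Q i := `[< U i !=set0 >].
pose tau i := kap / 2 ^+ i.+1.
have tau0 i : 0 < tau i by rewrite divr_gt0 // exprn_gt0.
have /choice[nx nxP] i : exists nx : nat * G, Q i -> U i `<=` coset nx.1 nx.2 /\
    (((D nx.1)^-1 `^ s)%:E <= diameter_pow dist s (U i) + (tau i)%:E)%E.
  have [/asboolP[x Ux]|nQ] := boolP (Q i); last by exists (0%N, 1%g).
  have [n hn] := cover_piece s0 (tau0 i) unb Ux (Ui1 i).
  by exists (n, x).
pose V i := if Q i then coset (nx i).1 (nx i).2 else set0.
have [|x Hx|k Hk] := @compact_sequence_cover V.
- move=> i; rewrite /V; case: ifP => _; last exact: open0.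
  exact: open_right_coset.
- have [i _ Uix] := cov x Hx; exists i => //; rewrite /V.
  have Qi : Q i by apply/asboolP; exists x.
  by rewrite Qi; have [/(_ x Uix)] := nxP i Qi.
have := @coset_cover_sum k Q (fun i => (nx i).1) (fun i => (nx i).2).
have cov' : H `<=` \bigcup_(i in [set i | (i < k)%N /\ Q i]) coset (nx i).1 (nx i).2.
  by move=> x /Hk[i /= ik]; rewrite /V; case: ifP => // Qi xi; exists i.
move=> /(_ cov') one.
have sum_tau : \sum_(i < k) tau i <= kap.
  have -> : \sum_(i < k) tau i = kap - kap / 2 ^+ k.
    elim: {Hk one cov'} k => [|k IHk]; first by rewrite big_ord0 expr0 divr1 subrr.
    rewrite big_ord_recr /= IHk /tau exprS; field.
    by rewrite expf_neq0.
  by rewrite gerBl divr_ge0 ?exprn_ge0 // ltW.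
have /(lt_le_trans (y := 1)) : \sum_(i < k | Q i) (count H (nx i).1)%:R^-1 < 1 :> RR.
  apply: le_lt_trans kapB.
  apply: (@le_trans _ _ (\sum_(i < k | Q i) B * ((D (nx i).1)^-1 `^ s))).
    by apply: ler_sum => i _; exact: mass.
  rewrite -mulr_sumr; apply: ler_wpM2l; first exact: ltW.
  rewrite -lee_fin -sumEFin.
  apply: (@le_trans _ _ (\sum_(i < k) (diameter_pow dist s (U i) + (tau i)%:E))%E).
    rewrite [leRHS](bigID (fun i : 'I_k => Q i)) /=.
    apply: (@le_trans _ _ (\sum_(i < k | Q i)
        (diameter_pow dist s (U i) + (tau i)%:E))%E).
      by apply: lee_sum => i Qi; have [] := nxP i Qi.
    rewrite leeDl //; apply: sume_ge0 => i _; apply: adde_ge0.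
      exact: diameter_pow_ge0.
    by rewrite lee_fin ltW.
  rewrite big_split /= sumEFin EFinD; apply: leeD; last by rewrite lee_fin.
  by have := ltW (partial k); rewrite big_mkord.
by move=> /(_ _ one); rewrite ltxx.
Qed.

End FiltrationHausdorffMeasure.

(** * Asymptotics of the counts *)

Section Asymptotics.
Variables (RR : realType) (q : RR) (q_gt1 : 1 < q) (a : nat -> nat).
Hypothesis a_ge : forall n, (n <= a n)%N.
Hypothesis a_slow : forall k M, exists n0, forall n, (n0 <= n)%N ->
  (M * a (n + k) <= M.+1 * a n)%N.
Variables (P D : nat -> RR) (d e K1 K2 K3 K4 : nat) (B1 B2 : RR).
Hypothesis d_gt0 : (0 < d)%N.
Hypotheses (B1_gt0 : 0 < B1) (B2_gt0 : 0 < B2).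
Hypotheses (P_ge1 : forall n, 1 <= P n) (D_ge1 : forall n, 1 <= D n).
Hypothesis D_le : forall k n, (k <= n)%N -> D k <= D n.
Hypothesis P_ge : forall i, q ^+ (a i * e) <= P (i + K1)%N.
Hypothesis P_le : forall n, P n <= B1 * q ^+ (a (n + K2)%N * e).
Hypothesis D_ge : forall i, q ^+ (a i * d) <= D (i + K3)%N.
Hypothesis D_le_pow : forall n, D n <= B2 * q ^+ (a (n + K4)%N * d).

Let q0 : 0 < q. Proof. exact: lt_trans q_gt1. Qed.
Let D_gt0 n : 0 < D n. Proof. exact: lt_le_trans (D_ge1 n). Qed.
Let P_gt0 n : 0 < P n. Proof. exact: lt_le_trans (P_ge1 n). Qed.

Lemma slow_growthR k (eta : RR) : 0 < eta -> exists n0, forall n, (n0 <= n)%N ->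
  (a (n + k)%N)%:R <= (1 + eta) * (a n)%:R.
Proof.
move=> eta0; pose M := (Num.bound eta^-1).+1.
have M1 : M%:R^-1 <= eta.
  rewrite -[leRHS]invrK lef_pV2 ?posrE ?invr_gt0 //.
  apply/ltW/(lt_le_trans (archi_boundP _)); first by rewrite invr_ge0 ltW.
  by rewrite ler_nat.
have [n0 hn] := a_slow k M; exists n0 => n /hn.
rewrite -(ler_nat RR) !natrM -[M.+1]addn1 natrD => h.
have M0 : 0 < M%:R :> RR by rewrite ltr0n.
rewrite -(ler_pM2l M0); apply: le_trans h _.
rewrite mulrA; apply: ler_wpM2r => //.
by rewrite mulrDr mulr1 lerD2l -ler_pdivrMl // mulr1.
Qed.

Lemma powR_nat n (x : RR) : (q ^+ n) `^ x = q `^ (n%:R * x).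
Proof. by rewrite powRrM powR_mulrn // ltW. Qed.

Lemma exp_a_ge y : exists n0, forall i, (n0 <= i)%N -> y <= q ^+ (a i * d).
Proof.
have [k hk] := exp_unbounded q_gt1 y; exists k => i ki; apply: le_trans hk _.
rewrite ler_eXn2l //; apply: leq_trans ki _; apply: leq_trans (a_ge i) _.
by rewrite leq_pmulr.
Qed.

Lemma index_unbounded y : exists n, y <= D n.
Proof.
have [n0 /(_ n0 (leqnn _)) h] := exp_a_ge y.
by exists (n0 + K3)%N; apply: le_trans h _; exact: D_ge.
Qed.

Lemma index_inv_powR n s : (D n)^-1 `^ s = (D n `^ s)^-1.
Proof. by rewrite -powR_inv1 ?ltW // -powRrM mulN1r powRN. Qed.

Lemma cover_small s eps delta : e%:R / d%:R < s -> 0 < eps -> 0 < delta ->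
  exists n, (D n)^-1 <= delta /\ P n * ((D n)^-1 `^ s) <= eps.
Proof.
rewrite ltr_pdivrMr ?ltr0n // => eds eps0 delta0.
have s0 : 0 <= s.
  by rewrite -(pmulr_lge0 (x := d%:R)) ?ltr0n //; apply: le_trans (ltW eds).
(* The gap [s * d - e] is split in two: one half pays for the index shift in [a], the other absorbs
   [B1 / eps]. Dividing by [e + 1] below allows [e = 0]. *)
pose th := (s * d%:R - e%:R) / 2; have th0 : 0 < th by rewrite divr_gt0 ?subr_gt0.
have e1 : 0 < e%:R + 1 :> RR by rewrite ltr_wpDl.
have [n0 slow] := slow_growthR (K3 + K2)%N (divr_gt0 th0 e1).
have qth : 1 < q `^ th.
  rewrite /powR gt_eqF // expR_gt1 mulr_gt0 // ln_gt0 //.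
have [n1 big1] := exp_unbounded qth (B1 / eps).
have [n2 big2] := exp_a_ge delta^-1.
pose i := maxn n0 (maxn n1 n2).
have i0 : (n0 <= i)%N by rewrite leq_maxl.
have i1 : (n1 <= i)%N by rewrite !leq_max leqnn orbT.
have i2 : (n2 <= i)%N by rewrite !leq_max leqnn !orbT.
exists (i + K3)%N; split.
  rewrite -[leRHS]invrK lef_pV2 ?posrE ?invr_gt0 //.
  exact: le_trans (big2 _ i2) (D_ge _).
rewrite index_inv_powR ler_pdivrMr ?powR_gt0 //.
apply: le_trans (P_le _) _.
have Ds : q `^ ((a i * d)%:R * s) <= D (i + K3)%N `^ s.
  rewrite -powR_nat; apply: ge0_ler_powR => //; rewrite ?nnegrE.
  - by rewrite exprn_ge0 // ltW.
  - exact: ltW.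
apply: le_trans (_ : eps * q `^ ((a i * d)%:R * s) <= _); last first.
  by rewrite ler_pM2l.
have : B1 <= eps * q `^ (th * (a i)%:R).
  rewrite mulrC -ler_pdivrMr //; apply: le_trans big1 _.
  rewrite -powR_mulrn ?powR_ge0 // -powRrM; apply: ler_powR; first exact: ltW.
  rewrite ler_pM2l // ler_nat; exact: leq_trans i1 (a_ge i).
move=> hB; apply: le_trans (ler_wpM2r _ hB) _; first by rewrite exprn_ge0 // ltW.
rewrite -mulrA ler_pM2l // -powR_mulrn ?(ltW q0) // -powRD; last first.
  by rewrite (gt_eqF q0) implybT.
apply: ler_powR; first exact: ltW.
have := slow _ i0; rewrite addnA => sl.
have ai : 0 <= (a i)%:R :> RR by [].
have e0 : 0 <= e%:R :> RR by [].
have : e%:R * (a (i + K3 + K2))%:R <= e%:R * ((1 + th / (e%:R + 1)) * (a i)%:R) :> RR.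
  exact: ler_wpM2l.
have : e%:R * (th / (e%:R + 1)) <= th.
  rewrite mulrA ler_pdivrMr // mulrDr mulr1 [th * _]mulrC lerDl; exact: ltW.
move=> /(ler_wpM2r ai) h1 h2.
rewrite !natrM; rewrite /th in h1 h2 *; nra.
Qed.

Lemma mass_bound s : 0 < s -> s < e%:R / d%:R ->
  exists B, 0 < B /\ forall n, (P n)^-1 <= B * ((D n)^-1 `^ s).
Proof.
move=> s0; have d0 : 0 < d%:R :> RR by rewrite ltr0n.
rewrite ltr_pdivlMr // => sde; have sd0 : 0 < s * d%:R by rewrite mulr_gt0.
(* This growth rate [eta] solves [s * d * (1 + eta) = e]. *)
have eta0 : 0 < (e%:R - s * d%:R) / (s * d%:R) by rewrite divr_gt0 ?subr_gt0.
have [n1 slow] := slow_growthR (K1 + K4)%N eta0.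
(* The first summand serves the large [n]; the second, by monotonicity of [D], the finitely many
   small ones. *)
pose B := B2 `^ s + D (n1 + K1)%N `^ s.
have B0 : 0 < B by rewrite addr_gt0 ?powR_gt0.
exists B; split=> // n.
suff h : D n `^ s <= B * P n.
  rewrite index_inv_powR -[leLHS]mul1r ler_pdivrMr // mulrAC ler_pdivlMr ?powR_gt0 //.
  by rewrite mul1r.
have [n1K|nK] := leqP (n1 + K1) n; last first.
  apply: le_trans (_ : D (n1 + K1)%N `^ s * P n <= _); last first.
    by apply: ler_wpM2r; [exact: ltW|rewrite lerDr powR_ge0].
  apply: le_trans (_ : D (n1 + K1)%N `^ s <= _); last first.
    by rewrite ler_peMr // powR_ge0.
  apply: ge0_ler_powR; rewrite ?nnegrE; try exact: ltW.
  by apply: D_le; exact: ltnW.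
pose i := (n - K1)%N; have nE : n = (i + K1)%N.
  by rewrite subnK //; apply: leq_trans n1K; exact: leq_addl.
have i1 : (n1 <= i)%N by rewrite -(leq_add2r K1) -nE.
apply: le_trans (_ : B2 `^ s * P n <= _); last first.
  by apply: ler_wpM2r; [exact: ltW|rewrite lerDl powR_ge0].
apply: (@le_trans _ _ ((B2 * q ^+ (a (n + K4)%N * d)) `^ s)).
  apply: ge0_ler_powR; rewrite ?nnegrE; try exact: ltW.
    by rewrite mulr_ge0 ?exprn_ge0 // ltW.
  exact: D_le_pow.
rewrite powRM ?exprn_ge0 ?(ltW B2_gt0) ?(ltW q0) // ler_pM2l ?powR_gt0 //.
rewrite nE; apply: le_trans (P_ge i); rewrite powR_nat -powR_mulrn ?(ltW q0) //.
apply: ler_powR; first exact: ltW.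
have := slow _ i1; rewrite addnA => sl; rewrite !natrM.
have := ler_wpM2l (ltW sd0) sl.
have -> : s * d%:R * ((1 + (e%:R - s * d%:R) / (s * d%:R)) * (a i)%:R) = (a i)%:R * e%:R.
  by field; rewrite !gt_eqF.
by apply: le_trans; rewrite le_eqVlt; apply/orP; left; apply/eqP; ring.
Qed.

End Asymptotics.

(** * The Hausdorff dimension of an analytic subgroup *)

Lemma infinite_group_coordinates (RR : realType) (c : RR) (R : idomainType)
    (m : set R) (d : nat) (G : topologicalGroupType) (A : set (chart m G d))
    (N : nat) (S : set G) (phi : G -> adic m d) :
  full_atlas c A -> compact [set: G] -> infinite_set [set: G] ->
  open_standard_subgroup c A N S phi ->
  exists2 v : 'rV[R]_d, ideal_powV m N v & v != 0.
Proof.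
(* Without a nonzero vector the open subgroup [S] is trivial, and compactness makes [G] finite. The
   vector provides both [0 < d] and a nonzero element of [m]. *)
move=> hA cG infG hS; apply: contrapT => no; apply: infG.
have [S1 _ _] := std_subgroup hS.
have Strivial x : S x -> x = 1%g.
  move=> Sx; have [_ _ inj _ _] := atlas_chart hA (std_atlas hS).
  apply: inj; rewrite ?inE //= (std_phi1 hS); apply/eqP/negPn/negP => x0.
  by apply: no; exists (phi x) => //; exact: (std_phi_in hS).
have [g [_ _ gS]] := nclasses_enum
  (finite_right_cosets cG (std_open hS) (std_subgroup hS)).
apply: (@sub_finite_set _ _ (range g)).
  move=> x _; have [i /(right_cosetP (std_subgroup hS)) /Strivial xg] := gS x I.
  by exists i => //; rewrite -[x](mulgVK (g i)) xg mul1g.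
by apply: finite_image; exact: finite_finset.
Qed.

Theorem mainTheorem1 (RR : realType) (c : RR) (c_gt1 : 1 < c)
    (R : idomainType) (p : nat) (m : set R) (hR : pro_p_ring p m)
    (d : nat) (G : topologicalGroupType) (A : set (chart m G d))
    (hG : analytic_group c A) (hGpro : profinite G)
    (hGinf : infinite_set [set: G])
    (H : set G) (hH : analytic_subgroup A H)
    (e : nat) (hHdim : analytic_subgroup_dim A H e)
    (N : nat) (S : set G) (phi : G -> adic m d)
    (hS : open_standard_subgroup c A N S phi) :
  hDim RR (natural_filtration N S phi) H = (e%:R / d%:R)%:E.
Proof.
have [cG _ _] := hGpro; have hA := analytic_group_atlas hG.
have N0 : (0 < N)%N by case: hS.
have [v vN v0] := infinite_group_coordinates hA cG hGinf hS.
have d0 : (0 < d)%N.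
  rewrite lt0n; apply/eqP => d0; move: v vN v0; rewrite {}d0 => v _.
  by rewrite thinmx0 eqxx.
have /rV0Pn[k0 vk0] := v0.
have mvk0 : m (v ord0 k0).
  by apply/(ideal_pow1 (pro_p_ideal hR)); exact: ideal_pow_le (vN k0).
have [a [finQ QE a_ge a_slow]] := quot_card_growth hR vk0 mvk0.
set Gn := natural_filtration N S phi.
have sgGn n : is_subgroup (Gn n) by exact: (natural_filtration_subgroup c_gt1 hR hS).
have oGn n : open (Gn n) by exact: (natural_filtration_open hA hS).
have leGn k n : (k <= n)%N -> Gn n `<=` Gn k by exact: natural_filtration_le.
have [sgH _] := hH; have [x0 [C [E [Hx0 adC dimE]]]] := hHdim.
have [S1 _ _] := std_subgroup hS.
have sgT : is_subgroup [set: G] by split.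
have adS : adapted_chart A [set: G] 1%g (S, phi) fullv.
  split=> //=; [exact: (std_atlas hS)|exact: (std_phi1 hS)|].
  apply/seteqP; split=> [_ [x [_ Sx] <-]|w [_ [x Sx <-]]].
    by split; [exact: memvf|exists x].
  by exists x.
have dimT : \dim (@fullv {fraction R} 'rV[{fraction R}]_d) = d.
  by rewrite dimvf /dim /= mul1n.
have q1 := quot_card1_gt1 hR.
pose q : RR := (quot_card m 1)%:R; have q_gt1 : 1 < q by rewrite ltr1n.
pose P n : RR := (coset_count N S phi H n)%:R.
pose D n : RR := (subgroup_index (Gn n))%:R.
have QR n k : (quot_card m n ^ k)%:R = q ^+ (a n * k) :> RR.
  by rewrite natrX QE natrX exprM.
have [K1 P_ge] := coset_count_ge c_gt1 hR vk0 mvk0 hG cG hS sgH Hx0 adC dimE finQ.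
have [K2 [B1 P_le]] := coset_count_le c_gt1 hR vk0 mvk0 hG cG hS sgH Hx0 adC dimE finQ.
have [K3 D_ge] := coset_count_ge c_gt1 hR vk0 mvk0 hG cG hS sgT I adS dimT finQ.
have [K4 [B2 D_le]] := coset_count_le c_gt1 hR vk0 mvk0 hG cG hS sgT I adS dimT finQ.
have P_ge1 n : 1 <= P n.
  rewrite ler1n; apply: nclasses_gt0; first exact: finite_coset_image.
  by exists x0.
have D_ge1 n : 1 <= D n by rewrite ler1n -(ltr0n RR); exact: index_gt0.
have PR i : q ^+ (a i * e) <= P (i + K1)%N by rewrite -QR ler_nat.
(* The successor keeps the constant positive. *)
have PR' n : P n <= B1.+1%:R * q ^+ (a (n + K2)%N * e).
  rewrite -QR -natrM ler_nat; apply: leq_trans (P_le n) _.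
  by rewrite leq_mul2r leqnSn orbT.
have DR i : q ^+ (a i * d) <= D (i + K3)%N by rewrite -QR ler_nat; exact: D_ge.
have DR' n : D n <= B2.+1%:R * q ^+ (a (n + K4)%N * d).
  rewrite -QR -natrM ler_nat; apply: leq_trans (D_le n) _.
  by rewrite leq_mul2r leqnSn orbT.
have D_homo k n : (k <= n)%N -> D k <= D n by exact: index_le.
have clH := analytic_subgroup_closed c_gt1 hR vk0 mvk0 hG hS sgH Hx0 adC dimE.
have D_unb := index_unbounded q_gt1 a_ge d0 DR.
have ed0 : 0 <= e%:R / d%:R :> RR by rewrite divr_ge0.
rewrite /hDim /hausdorff_dim; apply/eqP; rewrite eq_le; apply/andP; split.
  apply/lee_addgt0Pr => eps eps0; apply: ereal_inf_lbound.
  exists (e%:R / d%:R + eps); last by rewrite EFinD.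
  split; first by rewrite addr_ge0 // ltW.
  apply: (hausdorff_measure_eq0 cG sgGn oGn); first by rewrite addr_ge0 // ltW.
  move=> eps' delta eps'0 delta0.
  by apply: (cover_small q_gt1 a_ge a_slow d0 D_ge1 PR' DR) => //; rewrite ltrDl.
(* No [s] below [e / d] has measure 0. The case [s = 0] is apart, because enlarging pieces to cosets
   requires [0 < s]. *)
apply: le_ereal_inf_tmp => _ [s [s0 hs] <-]; rewrite lee_fin leNgt; apply/negP => sed.
have [s_eq0|s_neq0] := eqVneq s 0.
  by move: hs; rewrite s_eq0; exact: (hausdorff_measure0_neq0 cG sgGn oGn sgH).
have s_gt0 : 0 < s by rewrite lt_def s_neq0.
have [B [B0 mass]] :=
  mass_bound q_gt1 a_slow d0 (ltr0Sn _ B2) P_ge1 D_ge1 D_homo PR DR' s_gt0 sed.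
exact: (hausdorff_measure_neq0 cG sgGn oGn leGn sgH clH s_gt0 B0 D_unb mass hs).
Qed.
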